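(* Let $X$ be a Banach space containing seminormalized basic sequences $(x_i)_i$ and, for every $n\in\mathbb{N}$, $(x^n_i)_i$, such that $0<\inf_{n,i}\|x^n_i\|\le\sup_{n,i}\|x^n_i\|<\infty$. Let $(z_i)_i$ be a seminormalized basic sequence, not necessarily in $X$. Assume: (1) the sequence $(x_i)_i$ has a spreading model $(\tilde x_i)_i$ such that $(\tilde x_i)_i<<(z_i)_i$; (2) there is a constant $C$ such that for every $n\in\mathbb{N}$ the sequence $(x^n_i)_i$ has a spreading model $(\tilde x^n_i)_i$ such that $(z_i)_{i=1}^n$ is $C$-dominated by $(\tilde x^n_i)_{i=1}^n$ ($C$ independent of $n$); (3) the sequence $(z_i)$ has a spreading model which has Property P2. Then there exist a closed subspace $Y$ of $X$ which has a basis and a bounded linear operator $T:Y\to X$ which is not a compact perturbation of a multiple of the inclusion map, i.e. there is no scalar $\lambda$ such that $T-\lambda i_{Y\to X}$ is compact, where $i_{Y\to X}$ is the inclusion map.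
   Context: Spreading model: a seminormalized basic sequence $(x_n)$ in a Banach space has spreading model $(\tilde x_n)$, a seminormalized basic sequence in some (possibly different) Banach space, if there is a sequence $\varepsilon_n\searrow0$ such that for all $n\in\mathbb{N}$, all scalars $(a_i)_{i=1}^n$ with $|a_i|\le1$, and all $n\le k_1<\dots<k_n$, $\left|\,\|\sum_{i=1}^n a_ix_{k_i}\|-\|\sum_{i=1}^n a_i\tilde x_i\|\,\right|<\varepsilon_n$. Domination on small coefficients: $c_{00}$ is the space of finitely supported scalar sequences. For seminormalized basic sequences $(x_n)$, $(z_n)$ (not necessarily in the same Banach space) and $\varepsilon>0$ let $\Delta_{(z_n),(x_n)}(\varepsilon)=\sup\{\|\sum a_ix_i\|:(a_i)\in c_{00},\ |a_i|\le\varepsilon \text{ for all } i,\ \|\sum a_iz_i\|\le1\}$. Write $(x_n)<<(z_n)$ (''$(z_n)$ s.c. dominates $(x_n)$'') if $\lim_{\varepsilon\searrow0}\Delta_{(z_n),(x_n)}(\varepsilon)=0$. $(z_i)_{i=1}^n$ is $C$-dominated by $(w_i)_{i=1}^n$ if $\|\sum_{i=1}^n a_iz_i\|\le C\|\sum_{i=1}^n a_iw_i\|$ for all scalars $(a_i)_{i=1}^n$. Property P2: a seminormalized basic sequence $(z_i)$ has Property P2 if for every $\rho>0$ there exists $M=M(\rho)\in\mathbb{N}$ such that whenever $(a_i)$ are scalars with $\|\sum a_iz_i\|=1$, then $|\{i:|a_i|\ge\rho\}|\le M$. *)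

(* Defs.v *)
(* K is the scalar field (a realType R, or R[i]); the norm
   of a normedModType K takes its values in K, so constants and bounds live in
   K too (in R[i], x <= y entails that y - x is a nonnegative real).
   Sequences are indexed from 0: the informal x_i, i >= 1, is x (i - 1). *)
From HB Require Import structures.
From mathcomp Require Import all_boot all_order all_algebra.
From mathcomp Require Import all_classical all_reals all_analysis.

Set Implicit Arguments.
Unset Strict Implicit.
Unset Printing Implicit Defensive.

Import Order.TTheory GRing.Theory Num.Theory.
Import numFieldNormedType.Exports.

Local Open Scope classical_set_scope.
Local Open Scope ring_scope.

Definition closed_span (K : numFieldType) (V : completeNormedModType K)
    (e : nat -> V) : set V :=
  closure [set v | exists (n : nat) (a : 'I_n -> K),
                     v = \sum_(i < n) a i *: e i].

Definition linear_subspace (K : numFieldType) (V : completeNormedModType K)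
    (Y : set V) : Prop :=
  Y 0 /\ forall (a : K) (u v : V), Y u -> Y v -> Y (a *: u + v).

Definition closed_subspace (K : numFieldType) (V : completeNormedModType K)
    (Y : set V) : Prop :=
  linear_subspace Y /\ closed Y.

Definition schauder_basis (K : numFieldType) (V : completeNormedModType K)
    (e : nat -> V) (Y : set V) : Prop :=
  (forall i, Y (e i)) /\
  (forall v, Y v -> exists! a : nat -> K,
                      series (fun i => a i *: e i) @ \oo --> v).

Definition basic_sequence (K : numFieldType) (V : completeNormedModType K)
    (e : nat -> V) : Prop :=
  schauder_basis e (closed_span e).

Definition seminormalized (K : numFieldType) (V : completeNormedModType K)
    (e : nat -> V) : Prop :=
  exists c d : K, 0 < c /\ forall i, c <= `|e i| <= d.

Definition seminormalized_basic (K : numFieldType)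
    (V : completeNormedModType K) (e : nat -> V) : Prop :=
  seminormalized e /\ basic_sequence e.

(* With indices from 0, the blocks x_{k_1}, ..., x_{k_n}, n <= k_1 < ... < k_n,
   n >= 1, become n.+1 vectors x (k i) with k increasing and n <= k i. *)
Definition spreading_model (K : numFieldType) (V W : completeNormedModType K)
    (x : nat -> V) (xt : nat -> W) : Prop :=
  seminormalized_basic xt /\
  exists eps : nat -> K,
    [/\ {homo eps : m n / (m <= n)%N >-> n <= m},
        eps @ \oo --> (0 : K) &
        forall (n : nat) (a : 'I_n.+1 -> K) (k : 'I_n.+1 -> nat),
          (forall i, `|a i| <= 1) ->
          (forall i j : 'I_n.+1, (i < j)%N -> (k i < k j)%N) ->
          (forall i, (n <= k i)%N) ->
          `| `|\sum_(i < n.+1) a i *: x (k i)|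
             - `|\sum_(i < n.+1) a i *: xt i| | < eps n].

(* Delta_{z,x}(eps), valued in the extended scalars as it may be infinite; for
   K = R[i] the supremum is the least upper bound for the partial order, i.e.
   that of a set of nonnegative reals (ereal_sup is this, for real K only).
   A finitely supported sequence is given by its coefficients below some N. *)
Definition sc_Delta (K : numFieldType) (V W : completeNormedModType K)
    (z : nat -> W) (x : nat -> V) (eps : K) : \bar K :=
  supremum -oo%E [set r | exists (N : nat) (a : 'I_N -> K),
    [/\ forall i, `|a i| <= eps,
        `|\sum_(i < N) a i *: z i| <= 1 &
        r = (`|\sum_(i < N) a i *: x i|)%:E]].

(* z s.c. dominates x, i.e. x << z *)
Definition sc_dominates (K : numFieldType) (V W : completeNormedModType K)
    (z : nat -> W) (x : nat -> V) : Prop :=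
  sc_Delta z x eps @[eps --> (0 : K)^'+] --> (0 : K)%:E.

(* the first n terms of z are C-dominated by the first n terms of w *)
Definition dominated (K : numFieldType) (V W : completeNormedModType K)
    (C : K) (n : nat) (z : nat -> V) (w : nat -> W) : Prop :=
  forall a : 'I_n -> K,
    `|\sum_(i < n) a i *: z i| <= C * `|\sum_(i < n) a i *: w i|.

Definition property_P2 (K : numFieldType) (V : completeNormedModType K)
    (z : nat -> V) : Prop :=
  forall rho : K, 0 < rho -> exists M : nat,
    forall (a : nat -> K) (v : V),
      series (fun i => a i *: z i) @ \oo --> v -> `|v| = 1 ->
      ([set i | rho <= `|a i|]%R #<= `I_M)%card.

(* Operators on a subspace Y are total functions; only their values on Y
   matter. *)
Definition bounded_linear_on (K : numFieldType)
    (V W : completeNormedModType K) (Y : set V) (T : V -> W) : Prop :=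
  (forall (a : K) (u v : V), Y u -> Y v -> T (a *: u + v) = a *: T u + T v) /\
  exists M : K, forall u, Y u -> `|T u| <= M * `|u|.

Definition compact_operator_on (K : numFieldType)
    (V W : completeNormedModType K) (Y : set V) (T : V -> W) : Prop :=
  precompact (T @` [set u | Y u /\ `|u| <= 1]).

(* Main.v *)
Require Import Defs.
From HB Require Import structures.
From mathcomp Require Import all_boot all_order all_algebra.
From mathcomp Require Import all_classical all_reals all_analysis.
From mathcomp Require Import complex.
From mathcomp Require Import ring lra zify.
Import Order.TTheory GRing.Theory Num.Theory.
Import numFieldNormedType.Exports.
Set Implicit Arguments.
Unset Strict Implicit.
Unset Printing Implicit Defensive.
Local Open Scope classical_set_scope.
Local Open Scope ring_scope.

(** Differences of terms of the rows x^n can be combined into a basic sequence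
    (e_j) for which e_j |-> d_j, where d_j is a difference of two terms of x far
    out, extends to a bounded operator T on the closed span of (e_j) that is not
    of the form lambda + compact.

    Choose thresholds rho_0 >= rho_1 >= ... tending to 0 and one row y^l of the
    family (x^n) for each level l, and let e_j be the sum over l <= j of
    2^-l (y^l_p - y^l_q) with indices p < q that are generic over everything
    chosen before. A sum with coefficients a_j splits by levels, level l
    consisting of the j >= l with rho_(l+1) <= |a_j| < rho_l; the j left out have
    |a_j| < rho_(j+1), which is summable. Four facts give boundedness:

    - Schreier-type unconditionality [level_bound]: if the sum of the a_j e_j has
      norm at most 1, then any of its terms with j >= l, in number bounded in
      terms of l, have in the spreading model of y^l a norm of order 2^l;
    - the spreading model of y^l dominates z on that many terms [gen_dominates];
    - Property P2 then bounds the number of terms of level l by some m_l, which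
      depends only on l and rho_(l+1), so that y^l can be chosen accordingly
      [level_row];
    - s.c. domination: as the coefficients of level l are below rho_l, the
      corresponding sum of the a_j d_j has norm at most 2 2^-l
      [sc_dominates_small].

    The sum over all levels converges [domination]. Applied to the levels from L
    on, the same estimate shows that T is small on vectors with small
    coefficients supported far out. By Property P2 there are normalized such
    vectors, so T - lambda is not compact for lambda <> 0; for lambda = 0 it is
    not compact because the d_j are separated [transfer_noncompact].

    The unconditionality does not use functionals. Genericity is taken along a
    free ultrafilter, and [gen] is the norm of a vector plus generic differences.
    Generic differences can be removed from a sum without increasing its norm
    [gen_add_diff], by averaging over a long chain of them, whose sum telescopes.
    Actual vectors chosen far enough behave like generic ones, uniformly in
    bounded coefficients [generic_pair]; hence the terms of a sum can be removed
    or made generic one by one, from the last to the first [prune_right]. *)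

(** * Limits along ultrafilters *)

Section Ultralimit.
Context (R : realType) (T : Type) (V : set_system T) (UV : UltraFilter V).
Implicit Types (f g : T -> R).

Let FV : ProperFilter V := @ultra_proper _ V UV.

Definition ulim f : R := sup [set r | V [set t | r <= f t]].

Definition bounded_real f := exists B, forall t, `|f t| <= B.

Lemma ulimP f (eta : R) : bounded_real f -> 0 < eta ->
  V [set t | `|f t - ulim f| < eta].
Proof.
move=> [B fB] eta0.
have fge t : - B <= f t by have := fB t; rewrite ler_norml => /andP[].
have fle t : f t <= B by have := fB t; rewrite ler_norml => /andP[].
have hS : has_sup [set r | V [set t | r <= f t]].
  split; first by exists (- B) => /=; apply: filterE.
  exists B => r /= /filter_ex [t /= rt]; exact: le_trans rt (fle t).
have V1 : V [set t | ulim f - eta < f t].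
  have [s /= Vs ltes] := sup_adherent eta0 hS.
  by apply: filterS Vs => t /=; apply: lt_le_trans.
have V2 : V [set t | f t < ulim f + eta].
  have [V3|V3] := in_ultra_setVsetC [set t | ulim f + eta <= f t] UV.
    have /= := sup_upper_bound hS V3.
    by rewrite -/(ulim f) gerDl leNgt eta0.
  by apply: filterS V3 => t /= /negP; rewrite -ltNge.
apply: filterS2 V1 V2 => t /= h1 h2; rewrite ltr_norml; lra.
Qed.

Lemma ulim_near_le f l : bounded_real f ->
  (forall eta, 0 < eta -> V [set t | f t <= l + eta]) -> ulim f <= l.
Proof.
move=> bf Vl; apply/ler_addgt0Pr => eta eta0.
have e0 : 0 < eta / 2 by lra.
have [t /= [h1 h2]] := filter_ex (filterI (Vl _ e0) (ulimP bf e0)).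
move: h2; rewrite ltr_norml; lra.
Qed.

Lemma ulim_near_ge f l : bounded_real f ->
  (forall eta, 0 < eta -> V [set t | l - eta <= f t]) -> l <= ulim f.
Proof.
move=> bf Vl; apply/ler_addgt0Pr => eta eta0.
have e0 : 0 < eta / 2 by lra.
have [t /= [h1 h2]] := filter_ex (filterI (Vl _ e0) (ulimP bf e0)).
move: h2; rewrite ltr_norml; lra.
Qed.

Lemma ulim_le f l : bounded_real f -> (forall t, f t <= l) -> ulim f <= l.
Proof.
move=> bf fl; apply: ulim_near_le => // eta eta0.
by apply: filterE => t /=; rewrite (le_trans (fl t)) // lerDl ltW.
Qed.

Lemma ulim_leD f g h : bounded_real f -> bounded_real g -> bounded_real h ->
  (forall t, h t <= f t + g t) -> ulim h <= ulim f + ulim g.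
Proof.
move=> bf bg bh hfg; apply: ulim_near_le => // eta eta0.
have e0 : 0 < eta / 2 by lra.
apply: filterS2 (ulimP bf e0) (ulimP bg e0) => t /=.
by rewrite !ltr_norml; have := hfg t; lra.
Qed.

Lemma ulimZ f (c : R) : 0 <= c -> bounded_real f ->
  ulim (fun t => c * f t) = c * ulim f.
Proof.
move=> c0 bf.
have bcf : bounded_real (fun t => c * f t).
  have [B fB] := bf; exists (c * B) => t.
  by rewrite normrM (ger0_norm c0) ler_wpM2l.
have k eta : 0 < eta -> V [set t | `|c * f t - c * ulim f| <= eta].
  move=> eta0; have e0 : 0 < eta / (c + 1) by rewrite divr_gt0 //; lra.
  apply: filterS (ulimP bf e0) => t /= /ltW h.
  rewrite -mulrBr normrM (ger0_norm c0).
  apply: (le_trans (ler_wpM2l c0 h)).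
  rewrite mulrA ler_pdivrMr; last lra.
  by rewrite mulrC ler_pM2l //; lra.
apply/eqP; rewrite eq_le; apply/andP; split.
  apply: ulim_near_le => // eta eta0; apply: filterS (k _ eta0) => t /=.
  by rewrite ler_norml; lra.
apply: ulim_near_ge => // eta eta0; apply: filterS (k _ eta0) => t /=.
by rewrite ler_norml; lra.
Qed.

End Ultralimit.

(** A property holds of the generic pair (p, q) when, for generic p, it holds
    for all q that are generic over p. *)
Definition pair_ultra (U : set_system nat) : set_system (nat * nat) :=
  [set A | U [set p | U [set q | A (p, q)]]].

Lemma pair_ultraP (U : set_system nat) :
  UltraFilter U -> UltraFilter (pair_ultra U).
Proof.
move=> UU; have FU := @ultra_proper _ U UU.
have P : ProperFilter (pair_ultra U).
  split.
    rewrite /pair_ultra /= => h.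
    by have [p /filter_ex[]] := filter_ex h.
  split.
  - by rewrite /pair_ultra /=; do 2!apply: filterE => ? /=.
  - move=> A B; rewrite /pair_ultra /= => hA hB.
    by apply: filterS2 hA hB => p /=; apply: filterI.
  - move=> A B sAB; rewrite /pair_ultra /=.
    by apply: filterS => p /=; apply: filterS => q /=; apply: sAB.
split => // G PG sUG; apply/seteqP; split => // A GA.
have [h|h] := in_ultra_setVsetC [set p | U [set q | A (p, q)]] UU => //.
have : pair_ultra U (~` A).
  rewrite /pair_ultra /=; apply: filterS h => p /= h.
  by have [//|] := in_ultra_setVsetC [set q | A (p, q)] UU.
move=> /sUG GnA; have [x []//] := filter_ex (filterI GA GnA).
Qed.

Lemma free_ultrafilter : exists U : set_system nat,
  UltraFilter U /\ forall k, U [set n | (k <= n)%N].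
Proof.
have [U [UU sU]] := ultraFilterLemma eventually_filter.
by exists U; split => // k; apply: sU; exists k.
Qed.

(** * Real-valued norms over real or complex scalars *)

(** Norms over K take their values in K; [re] turns them into real numbers. The
    third field says that balls of K are compact, in the form in which it is
    used: bounded families have limits along ultrafilters. Working from these
    three facts treats K = R and K = R[i] at once. *)
Record real_part (R : realType) (K : numFieldType) (emb : {rmorphism R -> K})
    (re : K -> R) : Prop := RealPart {
  real_part_mono : {mono emb : r s / r <= s};
  real_partK : forall k, 0 <= k -> emb (re k) = k;
  real_part_ultra : forall (T : Type) (V : set_system T) (f : T -> K),
    UltraFilter V -> (forall t, `|f t| <= 1) ->
    exists k, forall eta : R, 0 < eta -> V [set t | re `|f t - k| < eta] }.

Section RealNorm.
Context (R : realType) (K : numFieldType) (emb : {rmorphism R -> K})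
  (re : K -> R) (HR : real_part emb re).

Definition nm (W : normedZmodType K) (v : W) : R := re `|v|.

Lemma emb_ge0 r : (0 <= emb r) = (0 <= r).
Proof. by rewrite -(rmorph0 emb) (real_part_mono HR). Qed.

Lemma emb_lt r s : (emb r < emb s) = (r < s).
Proof. exact: (leW_mono (real_part_mono HR)). Qed.

Lemma emb_gt0 r : (0 < emb r) = (0 < r).
Proof. by rewrite -(rmorph0 emb) emb_lt. Qed.

Lemma embK r : 0 <= r -> re (emb r) = r.
Proof.
by move=> r0; apply: (inc_inj (real_part_mono HR));
  rewrite (real_partK HR) // emb_ge0.
Qed.

Lemma emb_nm (W : normedZmodType K) (v : W) : emb (nm v) = `|v|.
Proof. by rewrite (real_partK HR). Qed.

Lemma nm_le (W : normedZmodType K) (v : W) r : (nm v <= r) = (`|v| <= emb r).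
Proof. by rewrite -emb_nm (real_part_mono HR). Qed.

Lemma nm_lt (W : normedZmodType K) (v : W) r : (nm v < r) = (`|v| < emb r).
Proof. by rewrite -emb_nm emb_lt. Qed.

Lemma nm_ge (W : normedZmodType K) (v : W) r : (r <= nm v) = (emb r <= `|v|).
Proof. by rewrite -emb_nm (real_part_mono HR). Qed.

Lemma nm_ge0 (W : normedZmodType K) (v : W) : 0 <= nm v.
Proof. by rewrite nm_ge rmorph0. Qed.

Lemma nm0 (W : normedZmodType K) : nm (0 : W) = 0.
Proof. by rewrite /nm normr0 -(rmorph0 emb) embK. Qed.

Lemma nm_eq0 (W : normedZmodType K) (v : W) : (nm v == 0) = (v == 0).
Proof.
by rewrite -(inj_eq (inc_inj (real_part_mono HR))) emb_nm rmorph0 normr_eq0.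
Qed.

Lemma nm_gt0 (W : normedZmodType K) (v : W) : (0 < nm v) = (v != 0).
Proof. by rewrite lt_def nm_ge0 nm_eq0 andbT. Qed.

Lemma nmN (W : normedZmodType K) (v : W) : nm (- v) = nm v.
Proof. by rewrite /nm normrN. Qed.

Lemma nm_distC (W : normedZmodType K) (v w : W) : nm (v - w) = nm (w - v).
Proof. by rewrite /nm distrC. Qed.

Lemma nmD (W : normedZmodType K) (v w : W) : nm (v + w) <= nm v + nm w.
Proof. by rewrite nm_le rmorphD !emb_nm ler_normD. Qed.

Lemma nmB (W : normedZmodType K) (v w : W) : nm (v - w) <= nm v + nm w.
Proof. by rewrite -(nmN w) nmD. Qed.

Lemma nm_sum (W : normedZmodType K) (I : Type) (s : seq I) (P : pred I)
  (F : I -> W) : nm (\sum_(i <- s | P i) F i) <= \sum_(i <- s | P i) nm (F i).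
Proof.
elim/big_rec2: _ => [|i u v _ h]; first by rewrite nm0.
by apply: (le_trans (nmD _ _)); rewrite lerD2l.
Qed.

Lemma nmZ (W : normedModType K) (c : K) (v : W) : nm (c *: v) = nm c * nm v.
Proof.
apply: (inc_inj (real_part_mono HR)).
by rewrite rmorphM !emb_nm normrZ.
Qed.

Lemma nm_emb r : nm (emb r) = `|r|.
Proof.
have nn s : 0 <= s -> nm (emb s) = s.
  by move=> s0; rewrite /nm ger0_norm ?emb_ge0 // embK.
have [r0|/ltW r0] := leP 0 r; first by rewrite nn // ger0_norm.
by rewrite -nmN -rmorphN nn ?oppr_ge0 // ler0_norm.
Qed.

Lemma nmM (c d : K) : nm (c * d) = nm c * nm d.
Proof. exact: (@nmZ K^o). Qed.

Lemma nm_nat (n : nat) : nm (n%:R : K) = n%:R.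
Proof. by rewrite -(rmorph_nat emb) nm_emb ger0_norm. Qed.

Lemma bounded_nm_ultra (T : Type) (V : set_system T) (f : T -> K) (B : R) :
  UltraFilter V -> (forall t, nm (f t) <= B) ->
  exists k, nm k <= B /\
    forall eta : R, 0 < eta -> V [set t | nm (f t - k) < eta].
Proof.
move=> UV fB; have FV := @ultra_proper _ V UV.
suff [k Vk] : exists k, forall eta : R, 0 < eta ->
    V [set t | nm (f t - k) < eta].
  exists k; split => //; apply/ler_addgt0Pr => eta /Vk /filter_ex[t /= h].
  have -> : k = f t - (f t - k) by rewrite opprB addrC subrK.
  by apply: (le_trans (nmB _ _)); apply: lerD (fB t) (ltW h).
have B0 : 0 < `|B| + 1 by rewrite ltr_wpDl.
have Bn0 : emb (`|B| + 1) != 0 by rewrite gt_eqF // emb_gt0.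
have nB : nm (emb (`|B| + 1)) = `|B| + 1 by rewrite nm_emb gtr0_norm.
have [t|k Vk] := real_part_ultra HR (f := fun t => f t / emb (`|B| + 1)) UV.
  rewrite normrM normfV ler_pdivrMr ?normr_gt0 // mul1r -!emb_nm.
  rewrite (real_part_mono HR) nB (le_trans (fB t)) //.
  by rewrite (le_trans (ler_norm B)) // lerDl.
exists (k * emb (`|B| + 1)) => eta eta0.
have e0 : 0 < eta / (`|B| + 1) by rewrite divr_gt0.
apply: filterS (Vk _ e0) => t /=; rewrite -/(nm _) => h.
have -> : f t - k * emb (`|B| + 1) =
    (f t / emb (`|B| + 1) - k) * emb (`|B| + 1) by rewrite mulrBl divfK.
by rewrite nmM nB -ltr_pdivlMr.
Qed.

End RealNorm.

(** * Norms with generic terms *)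

Section GenericNorm.
Context (R : realType) (K : numFieldType) (emb : {rmorphism R -> K})
  (re : K -> R) (HR : real_part emb re).
Context (X : normedModType K) (U : set_system nat) (UU : UltraFilter U).
Local Notation nm := (nm re).

Local Notation V := (pair_ultra U).
#[local] Instance generic_pairs_ultra : UltraFilter V := pair_ultraP UU.
Local Notation UV := generic_pairs_ultra.

(** The norm of v + b_1 (y_p1 - y_q1) + ... + b_n (y_pn - y_qn), where each pair
    (p_i, q_i) is generic over v and over the pairs that precede it. For v = 0
    this is the norm of a combination of differences of the spreading model of
    y, when y has one; a general v places that spreading model over the whole
    space. Differences rather than single terms occur because a generic
    difference can be dropped from a sum without increasing the norm, even if y
    is not weakly null. *)
Fixpoint gen (y : nat -> X) (bs : seq K) (v : X) : R :=
  if bs is b :: bs' then ulim V (fun t => gen y bs' (v + b *: (y t.1 - y t.2)))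
  else nm v.

Section OneRow.
Context (y : nat -> X) (D : R) (yD : forall i, nm (y i) <= D).

Let D0 : 0 <= D.
Proof. exact: le_trans (nm_ge0 HR _) (yD 0). Qed.

Lemma nm_diff (t : nat * nat) : nm (y t.1 - y t.2) <= 2 * D.
Proof.
by apply: (le_trans (nmB HR _ _)); rewrite mulrDl mul1r lerD.
Qed.

Lemma gen_bounds bs v :
  0 <= gen y bs v <= nm v + 2 * D * \sum_(b <- bs) nm b.
Proof.
elim: bs v => [|b bs IH] v /=.
  by rewrite big_nil mulr0 addr0 lexx (nm_ge0 HR).
have bnd t : 0 <= gen y bs (v + b *: (y t.1 - y t.2))
    <= nm v + 2 * D * \sum_(c <- b :: bs) nm c.
  have /andP[h1 h2] := IH (v + b *: (y t.1 - y t.2)).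
  rewrite h1 (le_trans h2) // big_cons mulrDr addrA lerD2r.
  apply: (le_trans (nmD HR _ _)); rewrite lerD2l (nmZ HR) mulrC.
  by rewrite ler_wpM2r ?(nm_ge0 HR) // nm_diff.
have bf : bounded_real (fun t => gen y bs (v + b *: (y t.1 - y t.2))).
  exists (nm v + 2 * D * \sum_(c <- b :: bs) nm c) => t.
  by have /andP[h1 h2] := bnd t; rewrite ger0_norm.
apply/andP; split; last by apply: ulim_le => // t; case/andP: (bnd t).
apply: ulim_near_ge => // eta eta0; apply: filterE => t /=.
by case/andP: (bnd t) => + _; apply: le_trans; rewrite sub0r oppr_le0 ltW.
Qed.

Lemma gen_bounded bs v (b : K) :
  bounded_real (fun t => gen y bs (v + b *: (y t.1 - y t.2))).
Proof.
exists (nm v + 2 * D * (nm b + \sum_(c <- bs) nm c)) => t.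
have /andP[h1 h2] := gen_bounds bs (v + b *: (y t.1 - y t.2)).
rewrite ger0_norm // (le_trans h2) // mulrDr addrA lerD2r.
apply: (le_trans (nmD HR _ _)); rewrite lerD2l (nmZ HR) mulrC.
by rewrite ler_wpM2r ?(nm_ge0 HR) // nm_diff.
Qed.

(** Coefficients are indexed by an arbitrary list so that two lists of equal
    length can be added: [gen] is a seminorm in the coefficients and the vector
    jointly, but not in the vector alone. *)
Lemma genD (I : Type) (s : seq I) (f g : I -> K) v w :
  gen y [seq f i + g i | i <- s] (v + w) <=
  gen y [seq f i | i <- s] v + gen y [seq g i | i <- s] w.
Proof.
elim: s v w => [|i s IH] v w /=; first exact: (nmD HR).
apply: ulim_leD.
- exact: gen_bounded.
- exact: gen_bounded.
- exact: gen_bounded.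
- by move=> t; rewrite scalerDl addrACA.
Qed.

Lemma genZ (k : K) bs v : gen y [seq k * b | b <- bs] (k *: v) = nm k * gen y bs v.
Proof.
elim: bs v => [|b bs IH] v /=; first exact: (nmZ HR).
rewrite -(ulimZ UV (nm_ge0 HR k) (gen_bounded bs v b)); congr ulim.
by apply/funext => t; rewrite -IH [in RHS]scalerDr scalerA.
Qed.

Lemma gen_lip (I : Type) (s : seq I) (f g : I -> K) v w :
  gen y [seq f i | i <- s] v <= gen y [seq g i | i <- s] w +
    (nm (v - w) + 2 * D * \sum_(i <- s) nm (f i - g i)).
Proof.
have -> : [seq f i | i <- s] = [seq g i + (f i - g i) | i <- s].
  by apply: eq_map => i; rewrite addrC subrK.
have {1}-> : v = w + (v - w) by rewrite addrC subrK.
apply: (le_trans (genD _ _ _ _ _)); rewrite lerD2l.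
by have /andP[_] := gen_bounds [seq f i - g i | i <- s] (v - w); rewrite big_map.
Qed.

(** Removing a generic difference does not increase the norm. If adding one
    lowered the value by eta for generic pairs, one could chain generic indices
    p_0, p_1, ..., p_n with every step (p_i, p_(i+1)) in the bad set; the n
    inequalities add up to a bound for a bounded perturbation of n v, and the
    gain n eta is absurd for large n. *)
Lemma gen_add_diff (Y : nat -> X) (E : R) bs v (eta : R) :
  (forall i, nm (Y i) <= E) -> 0 < eta ->
  V [set t | gen y bs v - eta <= gen y bs (v + (Y t.1 - Y t.2))].
Proof.
move=> YE eta0; set A := gen y bs v - eta.
have [//|Vbad] :=
  in_ultra_setVsetC [set t | A <= gen y bs (v + (Y t.1 - Y t.2))] UV.
pose P p := U [set q | gen y bs (v + (Y p - Y q)) < A].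
have UP : U [set p | P p].
  rewrite /pair_ultra /= in Vbad; apply: filterS Vbad => p /=.
  by rewrite /P; apply: filterS => q /= /negP; rewrite -ltNge.
have [p0 Pp0] := filter_ex UP.
have chain n : exists p, P p /\
    gen y [seq n%:R * b | b <- bs] (n%:R *: v + (Y p0 - Y p)) <= n%:R * A.
  elim: n => [|n [p [Pp IH]]].
    exists p0; split => //; rewrite subrr addr0 mul0r.
    by rewrite genZ (nm0 HR) mul0r.
  have [p' [/= Pp' hp']] := filter_ex (filterI UP Pp).
  exists p'; split => //; rewrite -natr1.
  have -> : [seq (n%:R + 1) * b | b <- bs] = [seq n%:R * b + b | b <- bs].
    by apply: eq_map => b; rewrite mulrDl mul1r.
  have -> : (n%:R + 1) *: v + (Y p0 - Y p') =
      (n%:R *: v + (Y p0 - Y p)) + (v + (Y p - Y p')).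
    have -> : Y p0 - Y p' = (Y p0 - Y p) + (Y p - Y p') by rewrite addrA subrK.
    by rewrite scalerDl scale1r addrACA.
  apply: (le_trans (genD _ _ _ _ _)); rewrite map_id -natr1 mulrDl mul1r.
  exact: lerD IH (ltW hp').
have bound n : n%:R * eta <= 2 * E.
  have [p [_ h]] := chain n.
  have dv : n%:R *: v - (n%:R *: v + (Y p0 - Y p)) = - (Y p0 - Y p).
    by move: (Y p0 - Y p) => d; rewrite opprD addrA subrr add0r.
  have := gen_lip bs (fun b => n%:R * b) (fun b => n%:R * b) (n%:R *: v)
    (n%:R *: v + (Y p0 - Y p)).
  rewrite genZ (nm_nat HR) big1 => [|b _]; last by rewrite subrr (nm0 HR).
  rewrite mulr0 addr0 dv nmN => h2.
  have := nmB HR (Y p0) (Y p); have := YE p0; have := YE p.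
  by move: h; rewrite /A mulrBr; lra.
have := archi_boundP (divr_ge0 (le_trans (normr_ge0 (2 * E)) (lexx _)) (ltW eta0)).
rewrite ltr_pdivrMr // => /lt_le_trans/(_ (bound _)).
by rewrite ltNge ler_norm.
Qed.

Lemma gen_cons_near b bs v (eta : R) : 0 < eta ->
  V [set t | gen y (b :: bs) v - eta <= gen y bs (v + b *: (y t.1 - y t.2))].
Proof.
move=> eta0; apply: filterS (ulimP UV (gen_bounded bs v b) eta0) => t /=.
by rewrite ltr_norml => /andP[h _]; lra.
Qed.

(** Generic indices can be taken increasing and beyond any given one, so lower
    bounds valid for such indices pass to generic norms. *)
Lemma gen_ge (Ufree : forall k, U [set n | (k <= n)%N]) (A : R) bs v (N : nat) :
  (forall k : nat -> nat, (N <= k 0)%N ->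
     (forall i, (i.+1 < (size bs).*2)%N -> (k i < k i.+1)%N) ->
     A <= nm (v + \sum_(s < size bs)
                bs`_s *: (y (k s.*2) - y (k s.*2.+1)))) ->
  A <= gen y bs v.
Proof.
elim: bs v N => [|b bs IH] v N hA /=.
  by have := hA (fun=> N) (leqnn _); rewrite big_ord0 addr0; apply.
apply: ulim_near_ge; first exact: gen_bounded.
move=> eta eta0; have : V [set t | (N <= t.1)%N && (t.1 < t.2)%N].
  rewrite /pair_ultra /=; apply: filterS (Ufree N) => p /= Np.
  by apply: filterS (Ufree p.+1) => q /= ->; rewrite Np.
apply: filterS => -[p q] /= /andP[Np pq].
suff : A <= gen y bs (v + b *: (y p - y q)) by lra.
apply: (IH _ q.+1) => k qk kinc.
have := hA (fun i => if i is i'.+1 then if i' is i''.+1 then k i'' else q else p).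
rewrite big_ord_recl /= -addrA; apply => // -[|[|i]] //= hi.
by apply: kinc; move: hi; rewrite doubleS !ltnS.
Qed.

End OneRow.

(** A lower bound that holds at each point of a compact parameter set, for most
    t, holds uniformly for most t: otherwise take the limit of parameters at
    which it fails and use that F and G are Lipschitz. *)
Lemma ultra_uniform (N : nat) (L : R) (F : nat * nat -> (nat -> K) -> R)
    (G : (nat -> K) -> R) (delta : R) : 0 <= L -> 0 < delta ->
  (forall t p q, F t p <= F t q + L * \sum_(i < N) nm (p i - q i)) ->
  (forall p q, G p <= G q + L * \sum_(i < N) nm (p i - q i)) ->
  (forall p, (forall i, nm (p i) <= 1) -> forall eta, 0 < eta ->
     V [set t | G p - eta <= F t p]) ->
  V [set t | forall p, (forall i, nm (p i) <= 1) -> G p - delta <= F t p].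
Proof.
move=> L0 delta0 FL GL FG.
have [//|Vbad] := in_ultra_setVsetC
  [set t | forall p, (forall i, nm (p i) <= 1) -> G p - delta <= F t p] UV.
have /choice[p hp] : forall t, exists p : nat -> K, (forall i, nm (p i) <= 1) /\
    ((~ forall p, (forall i, nm (p i) <= 1) -> G p - delta <= F t p) ->
     F t p < G p - delta).
  move=> t; have [h|h] := pselect (forall p,
      (forall i, nm (p i) <= 1) -> G p - delta <= F t p).
    by exists (fun=> 0); split => // i; rewrite (nm0 HR).
  move/existsNP: h => [p /not_implyP[p1 /negP]]; rewrite -ltNge => h.
  by exists p.
have /choice[q hq] : forall i, exists k, nm k <= 1 /\
    forall eta : R, 0 < eta -> V [set t | nm (p t i - k) < eta].
  by move=> i; apply: (bounded_nm_ultra HR) => // t; case: (hp t).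
(* A margin of delta / c in every coordinate costs less than delta overall. *)
pose c := 2 * L * N%:R + 1.
have c0 : 0 < c by rewrite ltr_wpDl // !mulr_ge0.
have e0 : 0 < delta / c by rewrite divr_gt0.
have Vc : V [set t | forall i : 'I_N, nm (p t i - q i) < delta / c].
  exact: (@filter_forall _ _ (fun (i : 'I_N) t => nm (p t i - q i) < delta / c)
    V _ (fun i => (hq i).2 _ e0)).
have Vq := FG q (fun i => (hq i).1) _ e0.
have [t [[/= h1 h2] h3]] := filter_ex (filterI (filterI Vbad Vc) Vq).
have [_ /(_ h1) h4] := hp t.
have h5 : \sum_(i < N) nm (p t i - q i) <= N%:R * (delta / c).
  rewrite -[X in X%:R]card_ord -sum1_card natr_sum mulr_suml.
  by apply: ler_sum => i _; rewrite mul1r ltW.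
have := FL t q (p t); have := GL (p t) q.
under [X in _ -> _ <= _ + L * X -> _]eq_bigr do rewrite nm_distC.
have h6 : L * \sum_(i < N) nm (p t i - q i) <= L * (N%:R * (delta / c)).
  exact: ler_wpM2l.
have h7 : 2 * L * (N%:R * (delta / c)) + delta / c = delta.
  by rewrite mulrA -{2}[delta / c]mul1r -mulrDl -/c mulrC divfK // gt_eqF.
move: h3 => /=; lra.
Qed.

Arguments gen : simpl never.

Lemma sum_iota_le (E : nat -> R) m k N : (forall i, 0 <= E i) ->
  (m + k <= N)%N -> \sum_(i <- iota m k) E i <= \sum_(i < N) E i.
Proof.
move=> E0 le_mkN; rewrite -(big_mkord xpredT) /index_iota subn0.
rewrite -(subnKC le_mkN) iotaD big_cat iotaD big_cat /= add0n.
have S0 s : 0 <= \sum_(i <- s) E i by apply: sumr_ge0.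
by rewrite -addrA addrCA lerDl addr_ge0.
Qed.

(** The Lipschitz bound in the shape required by [ultra_uniform]: one sequence p
    carries the coefficients of f, of u, and of the generic terms. *)
Lemma gen_coef_lip (y f : nat -> X) (D : R) n m k N (u : X) (p q : nat -> K) :
  (forall i, nm (y i) <= D) -> nm u <= 2 * D ->
  (n < N)%N -> (m + k <= N)%N ->
  gen y [seq p i | i <- iota m k] (\sum_(i < n) p i *: f i + p n *: u) <=
  gen y [seq q i | i <- iota m k] (\sum_(i < n) q i *: f i + q n *: u) +
    (\sum_(i < n) nm (f i) + 4 * D) * \sum_(i < N) nm (p i - q i).
Proof.
move=> yD uD nN mkN; set S := \sum_(i < N) _.
have D0 : 0 <= D := le_trans (nm_ge0 HR _) (yD 0).
have d0 i : 0 <= nm (p i - q i) by exact: (nm_ge0 HR).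
apply: (le_trans (gen_lip yD _ _ q _ (\sum_(i < n) q i *: f i + q n *: u))).
rewrite lerD2l.
have h1 : \sum_(i <- iota m k) nm (p i - q i) <= S by apply: sum_iota_le.
have h2 : nm (p n - q n) <= S.
  have := @sum_iota_le (fun i => nm (p i - q i)) n 1 N d0.
  by rewrite big_seq1 addn1; apply.
have -> : \sum_(i < n) p i *: f i + p n *: u - (\sum_(i < n) q i *: f i + q n *: u)
    = \sum_(i < n) (p i - q i) *: f i + (p n - q n) *: u.
  rewrite opprD addrACA -sumrB scalerBl; congr (_ + _).
  by apply: eq_bigr => i _; rewrite scalerBl.
have h3 : nm (\sum_(i < n) (p i - q i) *: f i) <= (\sum_(i < n) nm (f i)) * S.
  apply: (le_trans (nm_sum HR _ _ _)); rewrite mulr_suml; apply: ler_sum => i _.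
  rewrite (nmZ HR) mulrC ler_wpM2l ?(nm_ge0 HR) //.
  have := @sum_iota_le (fun i => nm (p i - q i)) i 1 N d0.
  by rewrite big_seq1 addn1; apply; apply: ltn_trans nN.
have h4 : nm ((p n - q n) *: u) <= 2 * D * S.
  by rewrite (nmZ HR) mulrC ler_pM // (nm_ge0 HR).
have h5 : 2 * D * \sum_(i <- iota m k) nm (p i - q i) <= 2 * D * S.
  by rewrite ler_wpM2l // mulr_ge0.
have := nmD HR (\sum_(i < n) (p i - q i) *: f i) ((p n - q n) *: u).
have -> : (\sum_(i < n) nm (f i) + 4 * D) * S =
    (\sum_(i < n) nm (f i)) * S + (2 * D * S + 2 * D * S) by ring.
lra.
Qed.

(** A single generic pair serves all bounded coefficients at once: for fixed
    coefficients the bounds are [gen_add_diff] and [gen_cons_near], and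
    compactness makes them uniform. *)
Lemma generic_pair (y Y f : nat -> X) (D : R) n r (delta : R) :
  (forall i, nm (y i) <= D) -> (forall i, nm (Y i) <= D) -> 0 < delta ->
  V [set t | forall (a : nat -> K) c bs, (forall i, nm (a i) <= 1) ->
    nm c <= 1 -> size bs = r -> (forall b, b \in bs -> nm b <= 1) ->
    gen y bs (\sum_(i < n) a i *: f i) - delta <=
      gen y bs (\sum_(i < n) a i *: f i + c *: (Y t.1 - Y t.2)) /\
    (y = Y -> gen y (c :: bs) (\sum_(i < n) a i *: f i) - delta <=
      gen y bs (\sum_(i < n) a i *: f i + c *: (Y t.1 - Y t.2)))].
Proof.
move=> yD YD delta0.
have D0 : 0 <= D := le_trans (nm_ge0 HR _) (yD 0).
pose v (p : nat -> K) := \sum_(i < n) p i *: f i.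
pose F (t : nat * nat) (p : nat -> K) :=
  gen y [seq p i | i <- iota n.+1 r] (v p + p n *: (Y t.1 - Y t.2)).
have nN : (n < n.+1 + r)%N by rewrite leq_addr.
have L0 : 0 <= \sum_(i < n) nm (f i) + 4 * D.
  by rewrite addr_ge0 ?mulr_ge0 // sumr_ge0 // => i _; exact: (nm_ge0 HR).
have FL t p q : F t p <= F t q + (\sum_(i < n) nm (f i) + 4 * D) *
    \sum_(i < n.+1 + r) nm (p i - q i).
  by apply: gen_coef_lip => //; exact: (nm_diff YD).
have GL m k : (m + k <= n.+1 + r)%N -> forall p q : nat -> K,
    gen y [seq p i | i <- iota m k] (v p) <=
    gen y [seq q i | i <- iota m k] (v q) +
    (\sum_(i < n) nm (f i) + 4 * D) * \sum_(i < n.+1 + r) nm (p i - q i).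
  move=> mk p q.
  have := @gen_coef_lip y f D n m k (n.+1 + r)%N 0 p q yD.
  rewrite !scaler0 !addr0; apply => //.
  by rewrite (nm0 HR) mulr_ge0.
have VA : V [set t | forall p, (forall i, nm (p i) <= 1) ->
    gen y [seq p i | i <- iota n.+1 r] (v p) - delta <= F t p].
  apply: (ultra_uniform L0 delta0 FL (GL n.+1 r (leqnn _))) => p p1 eta eta0.
  have pYD i : nm (p n *: Y i) <= D.
    by rewrite (nmZ HR) -[leRHS]mul1r ler_pM ?(nm_ge0 HR).
  have := gen_add_diff yD [seq p i | i <- iota n.+1 r] (v p) pYD eta0.
  by apply: filterS => t /=; rewrite -scalerBr.
have VB : y = Y -> V [set t | forall p, (forall i, nm (p i) <= 1) ->
    gen y [seq p i | i <- iota n r.+1] (v p) - delta <= F t p].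
  move=> yY.
  apply: (ultra_uniform L0 delta0 FL (GL n r.+1 _)) => [|p p1 eta eta0].
    by rewrite addnS.
  rewrite /F -yY; exact: (gen_cons_near yD (p n) [seq p i | i <- iota n.+1 r]).
pose W := [set t | y = Y -> forall p, (forall i, nm (p i) <= 1) ->
    gen y [seq p i | i <- iota n r.+1] (v p) - delta <= F t p].
have VW : V W.
  have [yY|yY] := pselect (y = Y); last by apply: filterE => t /yY.
  by apply: filterS (VB yY) => t /= h _.
apply: filterS2 VA VW => t /= hA hB a c bs a1 c1 sbs bs1.
pose p i := if (i < n)%N then a i else (c :: bs)`_(i - n).
have p1 i : nm (p i) <= 1.
  rewrite /p; case: ifP => // _.
  have [lt_i|ge_i] := ltnP (i - n) (size (c :: bs)); last first.
    by rewrite nth_default // (nm0 HR).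
  have := mem_nth 0 lt_i; rewrite inE => /orP[/eqP-> //|]; exact: bs1.
have vp : v p = \sum_(i < n) a i *: f i.
  by apply: eq_bigr => i _; rewrite /p ltn_ord.
have pn : p n = c by rewrite /p ltnn subnn.
have mapp : [seq p i | i <- iota n r.+1] = c :: bs.
  have -> : r.+1 = size (c :: bs) by rewrite /= sbs.
  rewrite -[in LHS](addn0 n) iotaDl -map_comp -[RHS]take_size.
  rewrite -(map_nth_iota0 0 (leqnn _)); apply: eq_map => i.
  by rewrite /p /= ltnNge leq_addr /= addKn.
have mapp1 : [seq p i | i <- iota n.+1 r] = bs by case: mapp.
have := hA p p1; rewrite /F vp pn mapp1 => h; split => // yY.
by have := hB yY p p1; rewrite mapp /F vp pn mapp1.
Qed.

(** * A sequence built from generic combinations of the rows *)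

Section Rows.
Context (y : nat -> nat -> X) (D : R) (yD : forall l i, nm (y l i) <= D).

Definition weight (l : nat) : K := emb (2^-1 ^+ l).

Lemma nm_weight l : nm (weight l) = 2^-1 ^+ l.
Proof. by rewrite (nm_emb HR) ger0_norm // exprn_ge0 // invr_ge0. Qed.

Lemma nm_weight_le1 l : nm (weight l) <= 1.
Proof. by rewrite nm_weight exprn_ile1 // ?invr_ge0 // invf_le1 // ler1n. Qed.

Lemma nmM_le1 (c d : K) : nm c <= 1 -> nm d <= 1 -> nm (c * d) <= 1.
Proof.
by move=> c1 d1; rewrite (nmM HR) -[leRHS]mul1r ler_pM // (nm_ge0 HR).
Qed.

(** The vector e is a sum over l < k of differences of row l with weight 2^-l.
    It can be dropped, and it can be replaced by its part in any one row l, made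
    generic. The rows are added one at a time: the pair taken from row k is
    generic over everything added before it, so adding it does not lower the
    generic norms; to isolate the part in row k, the vector already built is
    dropped in the presence of one more generic term, hence the quantification
    over r. *)
Lemma generic_combination (f : nat -> X) n j k : (k <= j.+1)%N ->
  forall r (delta : R), 0 < delta ->
  exists e, nm e <= 2 * D * \sum_(l < k) 2^-1 ^+ l /\
    forall l (a : nat -> K) c bs, (l <= j)%N ->
      (forall i, nm (a i) <= 1) -> nm c <= 1 ->
      (size bs <= r)%N -> (forall b, b \in bs -> nm b <= 1) ->
      gen (y l) bs (\sum_(i < n) a i *: f i) - delta <=
        gen (y l) bs (\sum_(i < n) a i *: f i + c *: e) /\
      ((l < k)%N ->
       gen (y l) (c * weight l :: bs) (\sum_(i < n) a i *: f i) - delta <=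
        gen (y l) bs (\sum_(i < n) a i *: f i + c *: e)).
Proof.
elim: k => [|k IH] kj r delta delta0.
  exists 0; split; first by rewrite (nm0 HR) big_ord0 mulr0.
  by move=> l a c bs *; rewrite scaler0 addr0 lerBlDr lerDl ltW.
have d0 : 0 < delta / 2 by lra.
have [e [eD he]] := IH (ltnW kj) r.+1 _ d0.
pose f' i := if (i < n)%N then f i else e.
pose good (l : 'I_j.+1) (s : 'I_r.+2) (t : nat * nat) :=
    forall (a : nat -> K) c bs, (forall i, nm (a i) <= 1) ->
    nm c <= 1 -> size bs = s -> (forall b, b \in bs -> nm b <= 1) ->
    gen (y l) bs (\sum_(i < n.+1) a i *: f' i) - delta / 2 <=
      gen (y l) bs (\sum_(i < n.+1) a i *: f' i + c *: (y k t.1 - y k t.2)) /\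
    (y l = y k -> gen (y l) (c :: bs) (\sum_(i < n.+1) a i *: f' i) - delta / 2
      <= gen (y l) bs (\sum_(i < n.+1) a i *: f' i + c *: (y k t.1 - y k t.2))).
have Vgood l s : V (good l s) := generic_pair f' n.+1 s (yD l) (yD k) d0.
have [t ht] := filter_ex (@filter_forall _ _ (fun l t => forall s, good l s t) V _
  (fun l => @filter_forall _ _ (good l) V _ (Vgood l))).
exists (e + weight k *: (y k t.1 - y k t.2)); split.
  rewrite big_ord_recr /= mulrDr (le_trans (nmD HR _ _)) // lerD //.
  by rewrite (nmZ HR) nm_weight mulrC ler_wpM2r ?exprn_ge0 ?invr_ge0 ?(nm_diff (yD k)).
move=> l a c bs lj a1 c1 sbs bs1.
pose a' i := if (i < n)%N then a i else c.
have a'1 i : nm (a' i) <= 1 by rewrite /a'; case: ifP.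
have S' : \sum_(i < n.+1) a' i *: f' i = \sum_(i < n) a i *: f i + c *: e.
  rewrite big_ord_recr /= /a' /f' ltnn; congr (_ + _).
  by apply: eq_bigr => i _; rewrite ltn_ord.
have cw1 := nmM_le1 c1 (nm_weight_le1 k).
have sr2 : (size bs < r.+2)%N by rewrite ltnS ltnW.
have [hA hB] := ht (Ordinal (lj : (l < j.+1)%N)) (Ordinal sr2) a' _ bs a'1 cw1
  erefl bs1.
rewrite /= S' in hA hB.
have -> : \sum_(i < n) a i *: f i + c *: (e + weight k *: (y k t.1 - y k t.2)) =
    \sum_(i < n) a i *: f i + c *: e + (c * weight k) *: (y k t.1 - y k t.2).
  by rewrite scalerDr addrA scalerA.
have [h1 h2] := he l a c bs lj a1 c1 (leqW sbs) bs1.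
split; first lra.
rewrite ltnS leq_eqVlt => /orP[/eqP lk|/h2]; last by lra.
have cbs1 b : b \in c * weight l :: bs -> nm b <= 1.
  by rewrite inE => /orP[/eqP->|/bs1//]; rewrite lk.
have [h3 _] := he l a c (c * weight l :: bs) lj a1 c1 sbs cbs1.
by rewrite -lk in hB *; have := hB erefl; lra.
Qed.

(** Up to an error delta j, the last term of a sum of j + 1 terms can be dropped
    or replaced by a generic term of any row l <= j, in the presence of up to r
    j generic terms of that row. *)
Definition prunable (e : nat -> X) (r : nat -> nat) (delta : nat -> R) :=
  forall j l (a : nat -> K) bs, (l <= j)%N -> (forall i, nm (a i) <= 1) ->
    (size bs <= r j)%N -> (forall b, b \in bs -> nm b <= 1) ->
    gen (y l) bs (\sum_(i < j) a i *: e i) - delta j <=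
      gen (y l) bs (\sum_(i < j.+1) a i *: e i) /\
    gen (y l) (a j * weight l :: bs) (\sum_(i < j) a i *: e i) - delta j <=
      gen (y l) bs (\sum_(i < j.+1) a i *: e i).

Lemma generic_sequence (r : nat -> nat) (delta : nat -> R) :
  (forall j, 0 < delta j) ->
  exists e : nat -> X, (forall j, nm (e j) <= 4 * D) /\ prunable e r delta.
Proof.
move=> delta0.
have D0 : 0 <= D := le_trans (nm_ge0 HR _) (yD 0 0).
have hnext : forall fn : (nat -> X) * nat, exists e,
    nm e <= 2 * D * \sum_(l < fn.2.+1) 2^-1 ^+ l /\
    forall l (a : nat -> K) c bs, (l <= fn.2)%N ->
      (forall i, nm (a i) <= 1) -> nm c <= 1 ->
      (size bs <= r fn.2)%N -> (forall b, b \in bs -> nm b <= 1) ->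
      gen (y l) bs (\sum_(i < fn.2) a i *: fn.1 i) - delta fn.2 <=
        gen (y l) bs (\sum_(i < fn.2) a i *: fn.1 i + c *: e) /\
      ((l < fn.2.+1)%N ->
       gen (y l) (c * weight l :: bs) (\sum_(i < fn.2) a i *: fn.1 i) - delta fn.2
        <= gen (y l) bs (\sum_(i < fn.2) a i *: fn.1 i + c *: e)).
  by move=> [f n]; apply: generic_combination.
have [next hn] := choice hnext.
pose fix pre n := if n is n'.+1 then rcons (pre n') (next (nth 0 (pre n'), n'))
  else [::] : seq X.
pose e n := next (nth 0 (pre n), n).
have size_pre n : size (pre n) = n by elim: n => //= n IH; rewrite size_rcons IH.
have nth_pre n i : (i < n)%N -> (pre n)`_i = e i.
  elim: n => // n IH; rewrite ltnS leq_eqVlt /= nth_rcons size_pre.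
  by case/predU1P => [->|lt_in]; [rewrite ltnn eqxx | rewrite lt_in IH].
have sum_pre (a : nat -> K) n :
    \sum_(i < n) a i *: (pre n)`_i = \sum_(i < n) a i *: e i.
  by apply: eq_bigr => i _; rewrite nth_pre.
exists e; split=> [j|j l a bs lj a1 sbs bs1].
  have [h _] := hn (nth 0 (pre j), j); apply: (le_trans h) => /=.
  have -> : 4 * D = 2 * D * 2 by ring.
  rewrite ler_wpM2l ?mulr_ge0 //.
  elim: j.+1 => [|n IH]; first by rewrite big_ord0.
  rewrite big_ord_recl expr0; under eq_bigr do rewrite exprS.
  by rewrite -mulr_sumr; lra.
have [_ h] := hn (nth 0 (pre j), j).
have /= := h l a (a j) bs lj a1 (a1 j) sbs bs1.
by rewrite sum_pre big_ord_recr /= => -[h1 h2]; split => //; exact: h2.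
Qed.

End Rows.

Lemma ex_argmax (E : nat -> R) n :
  exists k, (k < n.+1)%N /\ forall i, (i < n.+1)%N -> E i <= E k.
Proof.
elim: n => [|n [k [kn hk]]].
  by exists 0; split => // i; rewrite ltnS leqn0 => /eqP->.
have [le_k|lt_k] := leP (E n.+1) (E k).
  exists k; split; first exact: ltnW.
  by move=> i; rewrite ltnS leq_eqVlt => /predU1P[->//|]; exact: hk.
exists n.+1; split => // i; rewrite ltnS leq_eqVlt => /predU1P[->//|/hk h].
exact: le_trans h (ltW lt_k).
Qed.

(** * Partial unconditionality of the sequence *)

Section PrunedSequence.
Context (y : nat -> nat -> X) (D : R) (yD : forall l i, nm (y l i) <= D).
Context (e : nat -> X) (r : nat -> nat) (delta : nat -> R).
Context (he : prunable y e r delta).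

(** Schreier-type unconditionality: terms are peeled off from the right; those
    selected by G become generic terms of row l, the others are dropped. *)
Lemma prune_right l (a : nat -> K) (G : pred nat) k n : (l <= n)%N ->
  (forall i, nm (a i) <= 1) ->
  (forall j, (n <= j)%N -> (count G (iota n k) <= r j)%N) ->
  gen (y l) [seq a j * weight l | j <- [seq j <- iota n k | G j]]
    (\sum_(i < n) a i *: e i) <=
  nm (\sum_(i < n + k) a i *: e i) + \sum_(i <- iota n k) delta i.
Proof.
move=> ln a1; elim: k n ln => [|k IH] n ln rG /=.
  by rewrite big_nil addr0 addn0.
have rG' j : (n.+1 <= j)%N -> (count G (iota n.+1 k) <= r j)%N.
  by move=> nj; apply: leq_trans (rG j (ltnW nj)); rewrite /= leq_addl.
have h := IH n.+1 (leqW ln) rG'.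
set bs := [seq a j * weight l | j <- [seq j <- iota n.+1 k | G j]] in h *.
have bs1 b : b \in bs -> nm b <= 1.
  by move=> /mapP[j _ ->]; apply: nmM_le1 => //; exact: nm_weight_le1.
have sbs : (size bs <= r n)%N.
  rewrite size_map size_filter; apply: leq_trans (rG n (leqnn _)).
  by rewrite /= leq_addl.
have [h1 h2] := he ln a1 sbs bs1.
rewrite big_cons addnS -addSn; case: ifP => _ /=; rewrite -/bs; lra.
Qed.

Context (gamma : R) (gamma0 : 0 < gamma).
Context (hgamma : forall b, gamma * nm b <= gen (y 0) [:: b] 0).
Context (r_gt0 : forall j, (0 < r j)%N).
Context (delta_gamma : forall n k, \sum_(i <- iota n k) delta i <= gamma / 2).

(** Normalise so that the largest coefficient is 1, and keep only that term. *)
Lemma coef_bound (a : nat -> K) N k : (k < N)%N ->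
  nm (a k) <= 2 / gamma * nm (\sum_(i < N) a i *: e i).
Proof.
case: N => // N kN; have [m [mN hm]] := ex_argmax (fun i => nm (a i)) N.
apply: (le_trans (hm k kN)) => {k kN}.
have [am0|am0] := eqVneq (a m) 0.
  by rewrite am0 (nm0 HR) mulr_ge0 ?divr_ge0 ?(nm_ge0 HR) // ltW.
have nam0 : 0 < nm (a m) by rewrite (nm_gt0 HR).
have ninv : nm (a m)^-1 = (nm (a m))^-1.
  by apply: (mulfI (lt0r_neq0 nam0)); rewrite -(nmM HR) !divff ?(nm_nat HR 1) // gt_eqF.
pose a' i := if (i < N.+1)%N then (a m)^-1 * a i else 0.
have a'1 i : nm (a' i) <= 1.
  rewrite /a'; case: ifP => [iN|_]; last by rewrite (nm0 HR).
  by rewrite (nmM HR) ninv mulrC ler_pdivrMr // mul1r hm.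
have := @prune_right 0 a' (pred1 m) N.+1 0 (leqnn _) a'1.
have cm : (count (pred1 m) (iota 0 N.+1) = 1)%N.
  by rewrite count_uniq_mem ?iota_uniq // mem_iota mN.
rewrite cm => /(_ (fun j _ => r_gt0 j)).
have -> : [seq j <- iota 0 N.+1 | pred1 m j] = [:: m].
  by apply: filter_pred1_uniq; rewrite ?iota_uniq // mem_iota mN.
rewrite big_ord0 /= /a' mN mulVf // mul1r add0n.
have -> : \sum_(i < N.+1) (if (i < N.+1)%N then (a m)^-1 * a i else 0) *: e i =
    (a m)^-1 *: \sum_(i < N.+1) a i *: e i.
  by rewrite scaler_sumr; apply: eq_bigr => i _; rewrite ltn_ord scalerA.
rewrite (nmZ HR) ninv; have := hgamma (weight 0).
rewrite nm_weight expr0 mulr1; have := delta_gamma 0 N.+1.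
set s := nm (\sum_(_ < _) _); set d := \sum_(_ <- _) _ => h1 h2 h3.
have : gamma / 2 <= (nm (a m))^-1 * s by lra.
by rewrite [leRHS]mulrC ler_pdivlMr // => h4; rewrite mulrAC ler_pdivlMr //; lra.
Qed.

(** The errors made when dropping terms are at most gamma / 2 times the largest
    coefficient, which [coef_bound] bounds by the norm of the sum. *)
Lemma prefix_bound (a : nat -> K) n N : (n <= N)%N ->
  nm (\sum_(i < n) a i *: e i) <= 2 * nm (\sum_(i < N) a i *: e i).
Proof.
case: n => [|n nN]; first by rewrite big_ord0 (nm0 HR) mulr_ge0 ?(nm_ge0 HR).
pose c := 2 / gamma * nm (\sum_(i < N) a i *: e i).
have [c0|cp] := leP c 0.
  rewrite big1 ?(nm0 HR) ?mulr_ge0 ?(nm_ge0 HR) // => i _.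
  have := le_trans (coef_bound a (leq_trans (ltn_ord i) nN)) c0.
  by rewrite le_eqVlt ltNge (nm_ge0 HR) orbF (nm_eq0 HR) => /eqP->; rewrite scale0r.
pose a' i := if (i < N)%N then emb c^-1 * a i else 0.
have nc : nm (emb c^-1) = c^-1 by rewrite (nm_emb HR) gtr0_norm ?invr_gt0.
have a'1 i : nm (a' i) <= 1.
  rewrite /a'; case: ifP => [iN|_]; last by rewrite (nm0 HR).
  by rewrite (nmM HR) nc mulrC ler_pdivrMr // mul1r coef_bound.
have := @prune_right 0 a' pred0 (N - n.+1) n.+1 (leq0n _) a'1.
rewrite count_pred0 => /(_ (fun j _ => leq0n _)); rewrite filter_pred0 /=.
rewrite subnKC // /gen /a'.
have S k : (k <= N)%N ->
    \sum_(i < k) (if (i < N)%N then emb c^-1 * a i else 0) *: e i =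
    emb c^-1 *: \sum_(i < k) a i *: e i.
  move=> kN; rewrite scaler_sumr; apply: eq_bigr => i _.
  by rewrite (leq_trans (ltn_ord i)) // scalerA.
rewrite !S // !(nmZ HR) nc; have := delta_gamma n.+1 (N - n.+1).
set s1 := nm (\sum_(i < n.+1) _); set s := nm (\sum_(i < N) _); set d := \sum_(_ <- _) _.
move=> h1 h2; have : c^-1 * s1 <= c^-1 * s + gamma / 2 by lra.
rewrite mulrC ler_pdivrMr // mulrDl mulrAC mulVf ?gt_eqF // mul1r.
suff -> : gamma / 2 * c = s by move=> h; lra.
by rewrite /c -/s mulrA; field; rewrite gt_eqF.
Qed.

Context (delta_le1 : forall n k, \sum_(i <- iota n k) delta i <= 1).

(** The terms of index at least l that G selects are controlled by the whole
    sum, the factor 2^l undoing the weight of row l. The terms of index below l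
    are taken off separately, as their own norm is bounded by [prune_right] with
    nothing selected. *)
Lemma level_bound l (a : nat -> K) (G : pred nat) N :
  (forall i, nm (a i) <= 1) -> nm (\sum_(i < N) a i *: e i) <= 1 ->
  (forall j, G j -> (l <= j)%N) ->
  (forall j, (l <= j)%N -> (count G (iota 0 N) <= r j)%N) ->
  gen (y l) [seq a j | j <- [seq j <- iota 0 N | G j]] 0 <= 4 * 2 ^+ l.
Proof.
move=> a1 S1 Gl rG; have [Nl|lN] := leqP N l.
  have -> : [seq j <- iota 0 N | G j] = [::].
    apply/eqP; rewrite -size_eq0 size_filter -leqn0 leqNgt -has_count.
    apply/hasPn => j; rewrite mem_iota /= add0n => jN; apply/negP => /Gl.
    by rewrite leqNgt (leq_trans jN).
  by rewrite /gen /= (nm0 HR) mulr_ge0 // exprn_ge0.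
have Glist : [seq j <- iota 0 N | G j] = [seq j <- iota l (N - l) | G j].
  rewrite -{1}(subnKC (ltnW lN)) iotaD filter_cat add0n.
  have -> : [seq j <- iota 0 l | G j] = [::] => //.
  apply/eqP; rewrite -size_eq0 size_filter -leqn0 leqNgt -has_count.
  apply/hasPn => j; rewrite mem_iota /= add0n => jl; apply/negP => /Gl.
  by rewrite leqNgt jl.
have cG : count G (iota 0 N) = count G (iota l (N - l)).
  by rewrite -!size_filter Glist.
have := @prune_right l a G (N - l) l (leqnn _) a1.
rewrite -cG => /(_ rG); have := @prune_right l a pred0 (N - l) l (leqnn _) a1.
rewrite count_pred0 => /(_ (fun j _ => leq0n _)); rewrite filter_pred0 /=.
rewrite Glist (subnKC (ltnW lN)) => h1 h2; have := delta_le1 l (N - l).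
rewrite {1}/gen in h1; set s := [seq j <- _ | _] in h2 *.
have tE : [seq weight l * b | b <- map a s] = [seq a j * weight l | j <- s].
  by rewrite -map_comp; apply: eq_map => j /=; rewrite mulrC.
have := gen_lip (yD l) s (fun j => a j * weight l) (fun j => a j * weight l) 0
  (\sum_(i < l) a i *: e i).
rewrite sub0r nmN [X in _ * X]big1 => [|j _]; last by rewrite subrr (nm0 HR).
have := genZ (yD l) (weight l) (map a s) 0.
rewrite tE scaler0 nm_weight => -> h3 h4.
have : 2^-1 ^+ l * gen (y l) [seq a j | j <- s] 0 <= 4 by lra.
by rewrite exprVn mulrC ler_pdivrMr // exprn_gt0.
Qed.

End PrunedSequence.

(** * Summing over levels of coefficients *)

Section LevelSum.
Context (e d : nat -> X) (rho : nat -> R) (m : nat -> nat) (Dd : R).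
Context (dD : forall j, nm (d j) <= Dd).
Context (rho0 : rho 0 = 2).
Context (rho_gt0 : forall l, 0 < rho l).
Context (rho_decr : forall l, rho l.+1 <= rho l).
Context (rho_small : forall l, rho l.+1 <= 2^-1 ^+ l.+1).
Context (few_large : forall (a : nat -> K) N l,
  (forall i, nm (a i) <= 1) -> nm (\sum_(i < N) a i *: e i) <= 1 ->
  (count (fun j : nat => (l <= j)%N && (rho l.+1 <= nm (a j))%R) (iota 0 N) < m l)%N).
Context (level_small : forall (a : nat -> K) N l,
  (forall i, nm (a i) <= 1) -> nm (\sum_(i < N) a i *: e i) <= 1 -> (0 < l)%N ->
  nm (\sum_(j < N | [&& (l <= j)%N, rho l.+1 <= nm (a j) & nm (a j) < rho l])
        a j *: d j) <= 2 * 2^-1 ^+ l).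

Let Dd0 : 0 <= Dd.
Proof. exact: le_trans (nm_ge0 HR _) (dD 0). Qed.

(** A coefficient of index at least L and size below rho L either belongs to
    level L, or is below rho (L+1); in the latter case it is accounted for at
    the next level unless its index is L itself. *)
Lemma level_step (a : nat -> K) N L :
  nm (\sum_(j < N | (L <= j)%N && (nm (a j) < rho L)) a j *: d j) <=
  nm (\sum_(j < N | (L.+1 <= j)%N && (nm (a j) < rho L.+1)) a j *: d j) +
  (nm (\sum_(j < N | [&& (L <= j)%N, rho L.+1 <= nm (a j) & nm (a j) < rho L])
        a j *: d j) + rho L.+1 * Dd).
Proof.
have -> : \sum_(j < N | (L <= j)%N && (nm (a j) < rho L)) a j *: d j =
    \sum_(j < N | [&& (L <= j)%N, rho L.+1 <= nm (a j) & nm (a j) < rho L])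
      a j *: d j + \sum_(j < N | (L <= j)%N && (nm (a j) < rho L.+1)) a j *: d j.
  rewrite (bigID (fun j : 'I_N => rho L.+1 <= nm (a j))) /=; congr (_ + _).
    by apply: eq_bigl => j; rewrite -andbA; congr (_ && _); rewrite andbC.
  apply: eq_bigl => j; rewrite -andbA -ltNge; congr (_ && _).
  by apply/andP/idP => [[]//|h]; split => //; exact: lt_le_trans h (rho_decr L).
have -> : \sum_(j < N | (L <= j)%N && (nm (a j) < rho L.+1)) a j *: d j =
    \sum_(j < N | (L.+1 <= j)%N && (nm (a j) < rho L.+1)) a j *: d j +
    \sum_(j < N | ((L <= j)%N && (nm (a j) < rho L.+1)) && ~~ (L < j)%N)
      a j *: d j.
  rewrite (bigID (fun j : 'I_N => (L.+1 <= j)%N)) /=; congr (_ + _).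
  apply: eq_bigl => j; have [Lj|_] := ltnP L j; last by rewrite andbF.
  by rewrite (ltnW Lj) andbT.
set s1 := \sum_(j < N | [&& _, _ & _]) _.
set s2 := \sum_(j < N | (L < j)%N && _) _; set s3 := \sum_(j < N | _) _.
have h3 : nm s3 <= rho L.+1 * Dd.
  rewrite /s3; set Q := (X in \sum_(j < N | X j) _).
  have QL j : Q j -> j = L :> nat.
    rewrite /Q /= -leqNgt => /andP[/andP[Lj _] jL].
    by apply/eqP; rewrite eqn_leq jL Lj.
  case: (pickP Q) => [j Qj|Q0]; last first.
    by rewrite big_pred0 // (nm0 HR) mulr_ge0 // ltW.
  have -> : \sum_(i < N | Q i) a i *: d i = a j *: d j.
    apply: big_pred1 => i; rewrite /= ; apply/idP/eqP => [Qi|->//].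
    by apply: val_inj; rewrite /= (QL _ Qi) (QL _ Qj).
  rewrite (nmZ HR) ler_pM ?(nm_ge0 HR) //.
  by move: Qj; rewrite /Q /= => /andP[/andP[_ /ltW]].
have := nmD HR s1 (s2 + s3); have := nmD HR s2 s3; lra.
Qed.

(** Downward recursion on L with [level_step]: the right-hand side u(L) solves
    u(L) = u(L+1) + 2 2^-L + Dd 2^-(L+1). *)
Lemma tail_bound (a : nat -> K) N L : (forall i, nm (a i) <= 1) ->
  nm (\sum_(i < N) a i *: e i) <= 1 -> (0 < L)%N ->
  nm (\sum_(j < N | (L <= j)%N && (nm (a j) < rho L)) a j *: d j) <=
  (4 + Dd) * 2^-1 ^+ L.
Proof.
move=> a1 S1; have [k] := ubnP (N - L); elim: k L => // k IH L.
rewrite ltnS => NLk L0; have [NL|LN] := leqP N L.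
  rewrite big_pred0 => [|j]; last by rewrite leqNgt (leq_trans (ltn_ord j)).
  by rewrite (nm0 HR) mulr_ge0 ?addr_ge0 ?exprn_ge0.
have kL : (N - L.+1 < k)%N by rewrite subnS; apply: leq_trans NLk; rewrite prednK // subn_gt0.
have h1 := IH L.+1 kL isT; have h2 := level_small a1 S1 L0.
have h3 : rho L.+1 * Dd <= 2^-1 ^+ L.+1 * Dd by rewrite ler_wpM2r.
have := level_step a N L; move: h1 h3; rewrite exprS.
by set q := 2^-1 ^+ L in h2 *; nra.
Qed.

(** Level 0 consists of at most m 0 terms, which are bounded one by one; all the
    other levels sum up geometrically. *)
Lemma domination (a : nat -> K) N : (forall i, nm (a i) <= 1) ->
  nm (\sum_(i < N) a i *: e i) <= 1 ->
  nm (\sum_(j < N) a j *: d j) <= 4 + 2 * Dd + (m 0)%:R * Dd.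
Proof.
move=> a1 S1.
have -> : \sum_(j < N) a j *: d j =
    \sum_(j < N | (0 <= j)%N && (nm (a j) < rho 0)) a j *: d j.
  by apply: eq_bigl => j; rewrite rho0 (le_lt_trans (a1 j)) // ltr1n.
have h1 := tail_bound a1 S1 (ltn0Sn 0).
have h3 : rho 1 * Dd <= 2^-1 ^+ 1 * Dd by rewrite ler_wpM2r.
rewrite expr1 in h1 h3.
have h2 : nm (\sum_(j < N | [&& (0 <= j)%N, rho 1 <= nm (a j) & nm (a j) < rho 0])
    a j *: d j) <= (m 0)%:R * Dd.
  apply: (le_trans (nm_sum HR _ _ _)).
  apply: (@le_trans _ _ (\sum_(j < N | rho 1 <= nm (a j)) Dd)).
    rewrite [leLHS]big_mkcond [leRHS]big_mkcond; apply: ler_sum => j _ /=.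
    case: (rho 1 <= nm (a j)); last by [].
    case: ifP => _ //=.
    by rewrite (nmZ HR) -[leRHS]mul1r ler_pM ?(nm_ge0 HR).
  rewrite sumr_const -[leLHS]mulr_natl ler_wpM2r // ler_nat.
  apply: leq_trans (ltnW (few_large 0 a1 S1)).
  rewrite -sum1_count -sum1_card -(big_mkord (fun j => rho 1 <= nm (a j)) (fun=> 1%N)).
  by rewrite /index_iota subn0.
apply: (le_trans (level_step a N 0)); apply: (le_trans (lerD h1 (lerD h2 h3))).
by have := Dd0; lra.
Qed.

End LevelSum.

(** * Levels under control of the rows *)

(** The bound 4 * 2^l is the one supplied by [level_bound]. *)
Definition rows_detect_large (y : nat -> nat -> X) (rho : nat -> R)
    (m : nat -> nat) :=
  forall l bs, size bs = m l -> (forall b, b \in bs -> rho l.+1 <= nm b <= 1) ->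
    4 * 2 ^+ l < gen (y l) bs 0.

Definition rows_control_small (y : nat -> nat -> X) (rho : nat -> R)
    (m : nat -> nat) (x : nat -> X) (start : nat -> nat) :=
  forall l bs (k : nat -> nat), (0 < l)%N -> (size bs <= m l)%N ->
    (forall b, b \in bs -> nm b <= rho l) -> (forall b, b \in bs -> nm b <= 1) ->
    gen (y l) bs 0 <= 4 * 2 ^+ l -> (start l <= k 0)%N ->
    (forall i, (i.+1 < (size bs).*2)%N -> (k i < k i.+1)%N) ->
    nm (\sum_(s < size bs) bs`_s *: (x (k s.*2) - x (k s.*2.+1)))
      <= 2 * 2^-1 ^+ l.

Section GenericLevels.
Context (y : nat -> nat -> X) (D : R) (yD : forall l i, nm (y l i) <= D).
Context (e : nat -> X) (r : nat -> nat) (delta : nat -> R).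
Context (he : prunable y e r delta).
Context (delta_le1 : forall n k, \sum_(i <- iota n k) delta i <= 1).
Context (rho : nat -> R) (m : nat -> nat).
Context (mr : forall l j, (l <= j)%N -> (m l <= r j)%N).
Context (gen_large : rows_detect_large y rho m).

(** Otherwise keep the first m l of the large coefficients and make them generic
    in row l. *)
Lemma few_large_coef (a : nat -> K) N l :
  (forall i, nm (a i) <= 1) -> nm (\sum_(i < N) a i *: e i) <= 1 ->
  (count (fun j : nat => (l <= j) && (rho l.+1 <= nm (a j))%R) (iota 0 N) < m l)%N.
Proof.
move=> a1 S1; set G := (X in count X _); rewrite ltnNge; apply/negP => mG.
pose s := take (m l) [seq j <- iota 0 N | G j].
have ss : size s = m l by rewrite size_takel // size_filter.
have sub : subseq s (iota 0 N).
  by apply: (subseq_trans (take_subseq _ _)); exact: filter_subseq.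
have sG j : j \in s -> G j by move=> /mem_take; rewrite mem_filter => /andP[].
have Es := subseq_uniqP (iota_uniq 0 N) sub.
have := level_bound yD he delta_le1 (G := mem s) a1 S1.
rewrite -Es => /(_ l (fun j h => proj1 (andP (sG j h)))); rewrite leNgt.
have cs : count (mem s) (iota 0 N) = m l by rewrite -size_filter -ss [in RHS]Es.
rewrite cs => /(_ (mr (l := l))) /negP; apply; apply: gen_large.
  by rewrite size_map.
by move=> b /mapP[j /sG/andP[_ rj] ->]; rewrite rj a1.
Qed.

Context (x : nat -> X) (start : nat -> nat).
Context (gen_small : rows_control_small y rho m x start).
Context (kap : nat -> nat) (kap_incr : {homo kap : i j / (i < j)%N}).
Context (kap_start : forall l j, (l <= j)%N -> (start l <= kap j.*2)%N).

(** There are at most m l coefficients in level l, so that row l controls them.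
    *)
Lemma level_small_coef (a : nat -> K) N l :
  (forall i, nm (a i) <= 1) -> nm (\sum_(i < N) a i *: e i) <= 1 -> (0 < l)%N ->
  nm (\sum_(j < N | [&& (l <= j)%N, rho l.+1 <= nm (a j) & nm (a j) < rho l])
        a j *: (x (kap j.*2) - x (kap j.*2.+1))) <= 2 * 2^-1 ^+ l.
Proof.
move=> a1 S1 l0.
pose G j := [&& (l <= j)%N, rho l.+1 <= nm (a j) & nm (a j) < rho l].
pose s := [seq j <- iota 0 N | G j].
have sG j : j \in s -> G j by rewrite mem_filter => /andP[].
have cs : (size s <= m l)%N.
  apply: leq_trans (ltnW (few_large_coef l a1 S1)); rewrite size_filter.
  by apply: sub_count => j /and3P[-> -> _].
have gs : gen (y l) [seq a j | j <- s] 0 <= 4 * 2 ^+ l.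
  apply: (level_bound yD he delta_le1 a1 S1) => [j /andP[]//|j lj].
  by rewrite -size_filter (leq_trans cs) ?mr.
pose g := nth 0%N s.
have sl i : (i < size s)%N -> (l <= g i)%N.
  by move=> /(mem_nth 0%N)/sG/andP[].
have srt : {in [pred n | (n < size s)%N] &,
    {homo g : i j / (i < j)%N >-> (i < j)%N}}.
  apply: sorted_ltn_nth; first exact: ltn_trans.
  by apply: sorted_filter (iota_ltn_sorted 0 N); exact: ltn_trans.
have -> : \sum_(j < N | G j) a j *: (x (kap j.*2) - x (kap j.*2.+1)) =
    \sum_(i < size s) (map a s)`_i *:
      (x (kap (g i).*2) - x (kap (g i).*2.+1)).
  rewrite -(big_mkord G (fun j => a j *: (x (kap j.*2) - x (kap j.*2.+1)))).
  rewrite /index_iota subn0 -big_filter -/s (big_nth 0%N) big_mkord.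
  by apply: eq_bigr => i _; rewrite (nth_map 0%N).
have [s0|s0] := posnP (size s).
  by rewrite s0 big_ord0 (nm0 HR) mulr_ge0 ?exprn_ge0.
pose k i := kap ((g i./2).*2 + odd i)%N.
have := gen_small (k := k) l0 _ _ _ gs; rewrite size_map => /(_ cs).
have h i : (i < size s)%N -> k i.*2 = kap (g i).*2 /\ k i.*2.+1 = kap (g i).*2.+1.
  by move=> _; rewrite /k /= odd_double uphalf_double doubleK addn0 addn1.
under eq_bigr => i _ do rewrite (h i (ltn_ord i)).1 (h i (ltn_ord i)).2.
apply.
- by move=> b /mapP[j /sG/and3P[_ _ h1] ->]; exact: ltW.
- by move=> b /mapP[j _ ->].
- by rewrite /k /= addn0; apply: kap_start; exact: sl.
- move=> i i2; rewrite /k; apply: kap_incr => /=; rewrite uphalf_half.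
  case: (boolP (odd i)) => oi /=; last by rewrite add0n addn0 addn1.
  have i1 : (i./2.+1 < size s)%N.
    by rewrite -ltn_double; move: i2; rewrite -[i in (i.+1 < _)%N]odd_double_half oi.
  have := srt i./2 i./2.+1; rewrite !inE i1 (ltn_trans (ltnSn _) i1).
  rewrite add1n addn0 addn1 => /(_ isT isT (ltnSn _)) h1.
  by rewrite -doubleS leq_double in h1 * ; lia.
Qed.

End GenericLevels.

End GenericNorm.

(** * Closed subspaces with a basis, and operators defined on the basis *)

Section BasisAndOperator.
Context (R : realType) (K : numFieldType) (emb : {rmorphism R -> K})
  (re : K -> R) (HR : real_part emb re).
Context (X : completeNormedModType K).
Local Notation nm := (nm re).

Definition tends (u : nat -> X) (v : X) := forall eta : R, 0 < eta ->
  exists N, forall n, (N <= n)%N -> nm (v - u n) < eta.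

Lemma tendsP (u : nat -> X) (v : X) : u @ \oo --> v <-> tends u v.
Proof.
split=> [/cvgrPdist_lt h eta eta0|h].
  have e0 : 0 < emb eta by rewrite (emb_gt0 HR).
  have [N _ hN] := h _ e0; exists N => n Nn; rewrite (nm_lt HR); exact: hN.
apply/cvgrPdist_lt => eps eps0.
have [|N hN] := h (re eps); first by rewrite -(emb_gt0 HR) (real_partK HR) ?ltW.
exists N => // n /= Nn; rewrite -(real_partK HR (ltW eps0)) -(nm_lt HR).
exact: hN.
Qed.

Lemma tends_cauchy (u : nat -> X) :
  (forall eta : R, 0 < eta -> exists N, forall n, (N <= n)%N ->
     nm (u N - u n) < eta) -> exists v, tends u v.
Proof.
move=> h; have /cauchy_cvg cu : cauchy (u @ \oo).
  apply: cauchy_exP => eps eps0; have [|N hN] := h (re eps).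
    by rewrite -(emb_gt0 HR) (real_partK HR) ?ltW.
  exists (u N); exists N => // n /= Nn; rewrite -ball_normE /=.
  by rewrite -(real_partK HR (ltW eps0)) -(nm_lt HR); exact: hN.
by exists (lim (u @ \oo)); apply/tendsP; exact: cu.
Qed.

Lemma tends_le (u : nat -> X) (v : X) (A c : R) N0 : 0 <= c -> tends u v ->
  (forall n, (N0 <= n)%N -> A <= c * nm (u n)) -> A <= c * nm v.
Proof.
move=> c0 uv hA; apply/ler_addgt0Pr => eta eta0.
have e0 : 0 < eta / (c + 1) by rewrite divr_gt0 // ltr_wpDl.
have [N hN] := uv _ e0; pose n := maxn N0 N.
have h1 := hA n (leq_maxl _ _); have h2 := ltW (hN n (leq_maxr _ _)).
have h3 : nm (u n) <= nm v + eta / (c + 1).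
  rewrite -[u n](subKr v); apply: (le_trans (nmB HR _ _)); exact: lerD.
apply: (le_trans h1); apply: (le_trans (ler_wpM2l c0 h3)).
rewrite mulrDr lerD2l mulrA ler_pdivrMr ?ltr_wpDl // mulrC ler_wpM2l ?ltW //.
by rewrite ltrDl.
Qed.

Lemma tends_unique (u : nat -> X) v w : tends u v -> tends u w -> v = w.
Proof.
move=> /tendsP uv /tendsP uw; exact: (cvg_unique (@norm_hausdorff _ _) uv uw).
Qed.

Lemma tends_lin (u w : nat -> X) v v' (c : K) : tends u v -> tends w v' ->
  tends (fun n => c *: u n + w n) (c *: v + v').
Proof.
move=> /tendsP uv /tendsP wv; apply/tendsP; apply: cvgD => //.
exact: cvgZl_tmp.
Qed.

Lemma tends_stationary (u : nat -> X) v N : (forall n, (N <= n)%N -> u n = v) ->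
  tends u v.
Proof.
by move=> h eta eta0; exists N => n /h->; rewrite subrr (nm0 HR).
Qed.

Definition psum (e : nat -> X) (a : nat -> K) n := \sum_(i < n) a i *: e i.

Lemma psum_series e a : series (fun i => a i *: e i) = psum e a.
Proof. exact: seriesEord. Qed.

Lemma psum_lin e (c : K) a b n :
  psum e (fun i => c * a i + b i) n = c *: psum e a n + psum e b n.
Proof.
rewrite /psum scaler_sumr -big_split; apply: eq_bigr => i _ /=.
by rewrite scalerDl scalerA.
Qed.

Lemma psumB e a b n : psum e (fun i => a i - b i) n = psum e a n - psum e b n.
Proof. by rewrite /psum -sumrB; apply: eq_bigr => i _; rewrite scalerBl. Qed.

Lemma psum_tail e a n k : (n <= k)%N ->
  psum e (fun i => if (i < n)%N then 0 else a i) k = psum e a k - psum e a n.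
Proof.
move=> nk; rewrite -(subnKC nk) /psum !big_split_ord /=.
rewrite big1 ?add0r => [|i _]; last by rewrite ltn_ord scale0r.
rewrite [RHS]addrAC subrr add0r; apply: eq_bigr => i _.
by rewrite ltnNge leq_addr.
Qed.

(** The closed span of e when e is basic; this description makes the expansion
    part of the definition and leaves closedness to be proved. *)
Definition expansions (e : nat -> X) : set X :=
  [set v | exists a, tends (psum e a) v].

Context (e : nat -> X) (B : R).
Context (coefB : forall a N k, (k < N)%N -> nm (a k) <= B * nm (psum e a N)).
Context (prefix2 : forall a n N, (n <= N)%N ->
  nm (psum e a n) <= 2 * nm (psum e a N)).
Context (e_neq0 : forall i, e i != 0).

Let B0 : 0 <= B.
Proof.
have := @coefB (fun=> 1) 1 0 isT; rewrite (nm_nat HR 1) /psum big_ord1 scale1r.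
have : 0 < nm (e 0) by rewrite (nm_gt0 HR).
by move=> h1 h2; rewrite -(pmulr_lge0 _ h1) (le_trans _ h2).
Qed.

Lemma coef_lim a v k : tends (psum e a) v -> nm (a k) <= B * nm v.
Proof.
by move=> av; apply: (tends_le (N0 := k.+1) B0 av) => n kn; exact: coefB.
Qed.

Lemma prefix_lim a v n : tends (psum e a) v -> nm (psum e a n) <= 2 * nm v.
Proof.
by move=> av; apply: (tends_le (N0 := n) _ av) => // N nN; exact: prefix2.
Qed.

Lemma expansion_unique a b v : tends (psum e a) v -> tends (psum e b) v -> a = b.
Proof.
move=> av bv; apply/funext => k.
have h : tends (psum e (fun i => -1 * a i + b i)) 0.
  have -> : 0 = -1 *: v + v by rewrite scaleN1r addNr.
  have -> : psum e (fun i => -1 * a i + b i) = fun n => -1 *: psum e a n + psum e b n.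
    by apply/funext => n; exact: psum_lin.
  exact: tends_lin.
have := coef_lim k h; rewrite (nm0 HR) mulr0 => h1.
have : nm (-1 * a k + b k) == 0 by rewrite eq_le h1 (nm_ge0 HR).
by rewrite (nm_eq0 HR) mulN1r addrC subr_eq0 => /eqP.
Qed.

Lemma expansions_linear : linear_subspace (expansions e).
Proof.
split=> [|c u v [a au] [b bv]].
  exists (fun=> 0); apply: (tends_stationary (N := 0)) => n _.
  by rewrite /psum big1 // => i _; rewrite scale0r.
exists (fun i => c * a i + b i).
have -> : psum e (fun i => c * a i + b i) = fun n => c *: psum e a n + psum e b n.
  by apply/funext => n; exact: psum_lin.
exact: tends_lin.
Qed.

(** A limit of expandable vectors is expandable: the coefficients converge
    along an ultrafilter because they are controlled by the norm, and the
    uniform bound on partial sums controls the remainder. *)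
Lemma expansions_closed : closed (expansions e).
Proof.
move=> v vcl.
have inv0 k : 0 < k.+1%:R^-1 :> R by rewrite invr_gt0.
have /choice[wa hwa] : forall k : nat, exists wa : X * (nat -> K),
    tends (psum e wa.2) wa.1 /\ nm (v - wa.1) < k.+1%:R^-1.
  move=> k; have e0 : 0 < emb k.+1%:R^-1 by rewrite (emb_gt0 HR).
  have [w [[a aw]]] := vcl _ (nbhsx_ballx v _ e0).
  rewrite -ball_normE /= -(nm_lt HR) => vw.
  by exists (w, a).
pose w k := (wa k).1; pose a k := (wa k).2.
have aw k : tends (psum e (a k)) (w k) by case: (hwa k).
have vw k : nm (v - w k) < k.+1%:R^-1 by case: (hwa k).
have [U [UU Ufree]] := free_ultrafilter.
have wB k : nm (w k) <= nm v + 1.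
  rewrite -[w k](subKr v); apply: (le_trans (nmB HR _ _)); rewrite lerD2l.
  by apply: (le_trans (ltW (vw k))); rewrite invf_le1 // ler1n.
have /choice[b hb] : forall i, exists b, forall eta : R, 0 < eta ->
    U [set k | nm (a k i - b) < eta].
  move=> i; have [|b [_ hb]] := bounded_nm_ultra HR (f := fun k => a k i)
      (B := B * (nm v + 1)) UU.
    by move=> k; apply: (le_trans (coef_lim i (aw k))); rewrite ler_wpM2l.
  by exists b.
exists b => eta eta0.
have [k hk] : exists k, forall l, (k <= l)%N -> nm (v - w l) < eta / 12.
  have e0 : 0 <= 12 / eta by rewrite divr_ge0 // ltW.
  exists (Num.bound (12 / eta)) => l hl; apply: (lt_trans (vw l)).
  have := archi_boundP e0 => h.
  have h2 : 12 / eta < l.+1%:R.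
    by apply: (lt_le_trans h); rewrite ler_nat ltnW.
  rewrite -[X in _ < X]invrK ltf_pV2 ?posrE ?invr_gt0 ?divr_gt0 //.
  by rewrite invf_div.
have [N hN] := aw k _ (divr_gt0 eta0 (ltr0n R 3 : _ = true)).
exists N => n Nn.
pose c := 1 + \sum_(i < n) nm (e i).
have c0 : 0 < c by rewrite ltr_wpDr // sumr_ge0 // => i _; exact: (nm_ge0 HR).
have e0 : 0 < eta / 6 / c by rewrite !divr_gt0.
have Uc := @filter_forall _ _ (fun (i : 'I_n) l => nm (a l i - b i) < eta / 6 / c)
  U _ (fun i => hb i _ e0).
have [l [/= h1 kl]] := filter_ex (filterI (Uc _) (Ufree k)).
have h2 : nm (psum e (a l) n - psum e b n) <= eta / 6.
  rewrite -psumB; apply: (le_trans (nm_sum HR _ _ _)).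
  apply: (@le_trans _ _ (\sum_(i < n) eta / 6 / c * nm (e i))).
    by apply: ler_sum => i _; rewrite (nmZ HR) ler_wpM2r ?(nm_ge0 HR) // ltW.
  rewrite -mulr_sumr mulrAC ler_pdivrMr // ler_wpM2l ?divr_ge0 ?ltW //.
  by rewrite /c ltr_pwDl.
have h3 : nm (psum e (a k) n - psum e (a l) n) <= 2 * nm (w k - w l).
  have ta : tends (psum e (fun i => -1 * a l i + a k i)) (-1 *: w l + w k).
    have -> : psum e (fun i => -1 * a l i + a k i) =
        fun n => -1 *: psum e (a l) n + psum e (a k) n.
      by apply/funext => p; exact: psum_lin.
    exact: tends_lin.
  have := prefix_lim n ta; rewrite psum_lin !scaleN1r.
  by rewrite ![- _ + _]addrC.
have h4 : nm (w k - w l) <= eta / 12 + eta / 12.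
  rewrite -[w k - w l](_ : (v - w l) - (v - w k) = _); last first.
    by rewrite opprB addrC addrA subrK.
  by apply: (le_trans (nmB HR _ _)); rewrite lerD // ltW // hk.
have h5 := hN n Nn; have h6 := hk k (leqnn _).
have -> : v - psum e b n = (v - w k) + ((w k - psum e (a k) n) +
   ((psum e (a k) n - psum e (a l) n) + (psum e (a l) n - psum e b n))).
  by rewrite !addrA !subrK.
have := nmD HR (v - w k) ((w k - psum e (a k) n) +
   ((psum e (a k) n - psum e (a l) n) + (psum e (a l) n - psum e b n))).
have := nmD HR (w k - psum e (a k) n)
   ((psum e (a k) n - psum e (a l) n) + (psum e (a l) n - psum e b n)).
have := nmD HR (psum e (a k) n - psum e (a l) n) (psum e (a l) n - psum e b n).
lra.
Qed.

Lemma expansions_basis : schauder_basis e (expansions e).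
Proof.
split=> [i|v [a av]].
  exists (fun j => (j == i)%:R); apply: (tends_stationary (N := i.+1)) => n in_.
  rewrite /psum (bigD1 (Ordinal in_)) //= eqxx scale1r big1 ?addr0 // => j ji.
  by rewrite (_ : (j == i :> nat) = false) ?scale0r //; apply/negbTE.
exists a; split=> [|b]; rewrite psum_series; first exact/tendsP.
by move=> /tendsP bv; exact: expansion_unique av bv.
Qed.

Context (d : nat -> X) (C : R).
Context (domC : forall a N, nm (psum d a N) <= C * nm (psum e a N)).

Let C0 : 0 <= C.
Proof.
have := @domC (fun=> 1) 1; rewrite /psum !big_ord1 !scale1r.
have : 0 < nm (e 0) by rewrite (nm_gt0 HR).
by move=> h1 h2; rewrite -(pmulr_lge0 _ h1) (le_trans _ h2) // (nm_ge0 HR).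
Qed.

(** T is defined on expansions term by term; [domC] makes the image series
    Cauchy. *)
Lemma transfer_operator : exists T : X -> X,
  bounded_linear_on (expansions e) T /\
  forall a n, T (psum e a n) = psum d a n.
Proof.
have dconv a v : tends (psum e a) v -> exists w, tends (psum d a) w.
  move=> av; apply: tends_cauchy => eta eta0.
  have e0 : 0 < eta / (2 * C + 1) by rewrite divr_gt0 // ltr_wpDl // mulr_ge0.
  have [N hN] := av _ e0; exists N => n Nn.
  rewrite nm_distC -psum_tail //; apply: (le_lt_trans (domC _ _)).
  rewrite psum_tail //.
  have h : nm (psum e a n - psum e a N) <= 2 * (eta / (2 * C + 1)).
    rewrite -[X in nm X](_ : (v - psum e a N) - (v - psum e a n) = _); last first.
      by rewrite opprB addrC addrA subrK.
    apply: (le_trans (nmB HR _ _)); rewrite mulr2n mulrDl !mul1r.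
    by apply: lerD; apply: ltW; apply: hN.
  apply: (le_lt_trans (ler_wpM2l C0 h)).
  have c1 : 0 < 2 * C + 1 by rewrite ltr_wpDl // mulr_ge0.
  rewrite mulrA mulrA ltr_pdivrMr //.
  have -> : eta * (2 * C + 1) = C * (2 * eta) + eta by ring.
  by rewrite ltrDl.
have /choice[T hT] : forall v, exists w, forall a, tends (psum e a) v ->
    tends (psum d a) w.
  move=> v; have [[a av]|nv] := pselect (expansions e v); last first.
    by exists 0 => a av; case: nv; exists a.
  have [w aw] := dconv a v av; exists w => b bv.
  by rewrite -(expansion_unique av bv).
exists T; split; last first.
  move=> a n; pose b i := if (i < n)%N then a i else 0.
  have bn f N : (n <= N)%N -> psum f b N = psum f a n.
    move=> nN; rewrite -(subnKC nN) /psum big_split_ord /= /b.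
    rewrite [X in _ + X]big1 ?addr0 => [|i _]; last first.
      by rewrite ltnNge leq_addr scale0r.
    by apply: eq_bigr => i _; rewrite ltn_ord.
  apply: (tends_unique (u := psum d b)).
    by apply: hT; apply: (tends_stationary (N := n)) => N; exact: bn.
  by apply: (tends_stationary (N := n)) => N; exact: bn.
split=> [c u v [a au] [b bv]|].
  have lin f : psum f (fun i => c * a i + b i) =
      fun n => c *: psum f a n + psum f b n.
    by apply/funext => n; exact: psum_lin.
  apply: (tends_unique (u := psum d (fun i => c * a i + b i))).
    by apply: hT; rewrite lin; exact: tends_lin.
  by rewrite lin; apply: tends_lin; exact: hT.
exists (emb (C * 2)) => v [a av].
have h : nm (T v) <= C * 2 * nm v.
  apply/ler_addgt0Pr => eta eta0; have [N hN] := hT v a av eta eta0.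
  rewrite -[T v](subrK (psum d a N)); apply: (le_trans (nmD HR _ _)).
  rewrite addrC lerD ?(ltW (hN N _)) // (le_trans (domC _ _)) // -mulrA.
  by rewrite ler_wpM2l // prefix_lim.
by rewrite -(emb_nm HR v) -rmorphM -(nm_le HR).
Qed.

(** * Failure of compactness *)

Lemma geom_small (c eta : R) : 0 <= c -> 0 < eta ->
  exists k0, forall k, (k0 <= k)%N -> c * 2^-1 ^+ k <= eta.
Proof.
move=> c0 eta0; exists (Num.bound (c / eta)) => k hk.
rewrite exprVn ler_pdivrMr ?exprn_gt0 // mulrC -ler_pdivrMr // ltW //.
apply: (lt_le_trans (archi_boundP (divr_ge0 c0 (ltW eta0)))).
by rewrite -natrX ler_nat (leq_trans hk) // ltnW // ltn_expl.
Qed.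

Lemma precompact_close_terms (A : set X) (s : nat -> X) (eta : R) N :
  precompact A -> (forall k, A (s k)) -> 0 < eta ->
  exists i j, [/\ (N <= i)%N, (i < j)%N & nm (s i - s j) < eta].
Proof.
rewrite precompactE => cA sA eta0.
have [|p [_ clp]] := cA (s @ \oo) _.
  by exists 0%N => // k _ /=; apply: subset_closure.
have e0 : 0 < emb (eta / 2) by rewrite (emb_gt0 HR) divr_gt0.
have near_p M : exists2 i, (M <= i)%N & nm (p - s i) < eta / 2.
  have sM : (s @ \oo) [set s n | n in [set n | (M <= n)%N]].
    by exists M => // n /= Mn; exists n.
  have [_ [[i /= Mi <-]]] := clp _ _ sM (nbhsx_ballx p _ e0).
  by rewrite -ball_normE /= -(nm_lt HR) => h; exists i.
have [i Ni pi] := near_p N; have [j ij pj] := near_p i.+1.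
exists i, j; split => //.
rewrite -[s i - s j](_ : (p - s j) - (p - s i) = _); last first.
  by rewrite opprB addrC addrA subrK.
by apply: (le_lt_trans (nmB HR _ _)); lra.
Qed.

Context (E : R) (eE : forall j, nm (e j) <= E).
Context (gam : R) (gam0 : 0 < gam) (n0 : nat).
Context (d_sep : forall i j, (n0 <= i)%N -> (i < j)%N -> gam <= nm (d i - d j)).
Context (C' : R).
(* Normalized vectors arbitrarily far out that T nearly annihilates. *)
Context (flat_block : forall n, (0 < n)%N -> exists (a : nat -> K) N,
  [/\ forall i, (i < n)%N -> a i = 0, nm (psum e a N) = 1,
      nm (psum d a N) <= C' * 2^-1 ^+ n & forall i, (N <= i)%N -> a i = 0]).

(** T - lambda is not compact: if lambda = 0 look at the images d_j of the basis
    vectors, which are separated; otherwise look at successive disjoint blocks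
    which T nearly annihilates, while lambda keeps them apart. *)
Lemma transfer_noncompact (T : X -> X) :
  bounded_linear_on (expansions e) T ->
  (forall a n, T (psum e a n) = psum d a n) ->
  ~ exists lambda : K,
    compact_operator_on (expansions e) (fun u => T u - lambda *: u).
Proof.
move=> [Tlin _] Tpsum [lambda]; rewrite /compact_operator_on => comp.
have Ypsum a n : expansions e (psum e a n).
  exists (fun i => if (i < n)%N then a i else 0).
  apply: (tends_stationary (N := n)) => N nN.
  rewrite -(subnKC nN) /psum big_split_ord /= [X in _ + X]big1 ?addr0.
    by apply: eq_bigr => i _; rewrite ltn_ord.
  by move=> i _; rewrite ltnNge leq_addr scale0r.
have [l0|l0] := eqVneq lambda 0.
  have E0 : 0 < E.
    by apply: lt_le_trans (eE 0); rewrite (nm_gt0 HR).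
  have nE : nm (emb E^-1) = E^-1 by rewrite (nm_emb HR) gtr0_norm ?invr_gt0.
  (* v j is e j / E, written as a partial sum so that T can be evaluated. *)
  pose v j := psum e (fun i => (i == j)%:R * emb E^-1) j.+1.
  have sumv f j : psum f (fun i => (i == j)%:R * emb E^-1) j.+1 = emb E^-1 *: f j.
    rewrite /psum big_ord_recr /= eqxx mul1r big1 ?add0r // => i _.
    by rewrite ltn_eqF // mul0r scale0r.
  have [||i [j [ni ij]]] := @precompact_close_terms _
    (fun j => T (v j) - lambda *: v j) (gam / E) n0 comp.
  - move=> k; exists (v k) => //; split; first exact: Ypsum.
    rewrite -[X in _ <= X](rmorph1 emb) -(nm_le HR) /v sumv (nmZ HR) nE mulrC.
    by rewrite ler_pdivrMr // mul1r.
  - by rewrite divr_gt0.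
  rewrite /v !Tpsum !sumv l0 !scale0r !subr0 -scalerBr (nmZ HR) nE mulrC.
  by rewrite ltr_pM2r ?invr_gt0 // ltNge d_sep.
have lam0 : 0 < nm lambda by rewrite (nm_gt0 HR).
have /choice[aN haN] : forall n, exists aN : (nat -> K) * nat, (0 < n)%N ->
    [/\ forall i, (i < n)%N -> aN.1 i = 0, nm (psum e aN.1 aN.2) = 1,
      nm (psum d aN.1 aN.2) <= C' * 2^-1 ^+ n &
      forall i, (aN.2 <= i)%N -> aN.1 i = 0].
  by move=> [|n]; [exists (fun=> 0, 0%N)|have [//|a [N h]] := @flat_block n.+1; exists (a, N)].
(* Block k + 1 starts beyond the end of block k. *)
pose fix st k := if k is k'.+1 then maxn (st k').+1 (aN (st k')).2 else 1%N.
have st_gt k : (k < st k)%N.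
  by elim: k => //= k IH; rewrite leq_max !ltnS IH.
have st0 k : (0 < st k)%N by apply: leq_ltn_trans (st_gt k).
have st_mono : {homo st : i j / (i < j)%N}.
  by apply: homo_ltn => [? ? ?|k /=]; [exact: ltn_trans|rewrite leq_max leqnn].
have st_end i j : (i < j)%N -> ((aN (st i)).2 <= st j)%N.
  move=> ij; apply: (@leq_trans (st i.+1)); first by rewrite /= leq_maxr.
  by move: ij; rewrite leq_eqVlt => /predU1P[->//|/st_mono/ltnW].
pose a k := (aN (st k)).1; pose N k := (aN (st k)).2.
pose v k := psum e (a k) (N k).
have v1 k : nm (v k) = 1 by have [] := haN _ (st0 k).
have Tv k : nm (T (v k)) <= C' * 2^-1 ^+ (st k).
  by rewrite Tpsum; have [] := haN _ (st0 k).
have C'0 : 0 <= C'.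
  have := le_trans (nm_ge0 HR _) (Tv 0%N).
  by rewrite pmulr_lge0 // exprn_gt0 // invr_gt0.
have sep i j : (i < j)%N -> 1 <= 2 * nm (v i - v j).
  move=> ij; have [a0 _ _ _] := haN _ (st0 j).
  have ext k M : (N k <= M)%N -> psum e (a k) M = v k.
    move=> kM; rewrite -(subnKC kM) /v /psum big_split_ord /=.
    rewrite [X in _ + X]big1 ?addr0 // => p _.
    by have [_ _ _ z] := haN _ (st0 k); rewrite /a z ?scale0r // leq_addr.
  pose M := maxn (st j) (N j).
  have jM : (N j <= M)%N by rewrite leq_maxr.
  have iM : (N i <= M)%N by rewrite (leq_trans (st_end _ _ ij)) ?leq_maxl.
  have := @prefix2 (fun p => a i p - a j p) (st j) M (leq_maxl _ _).
  rewrite !psumB (ext i (st j)) ?st_end // (ext i M) // (ext j M) //.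
  suff -> : psum e (a j) (st j) = 0 by rewrite subr0 v1.
  by rewrite /psum big1 // => p _; rewrite /a a0 ?scale0r.
have [K0 hK0] : exists K0, forall k, (K0 <= k)%N ->
    C' * 2^-1 ^+ k <= nm lambda / 16.
  by apply: geom_small => //; rewrite divr_gt0.
have [||i [j [Ki ij]]] := @precompact_close_terms _
  (fun k => T (v k) - lambda *: v k) (nm lambda / 4) K0 comp.
- move=> k; exists (v k) => //; split; first exact: Ypsum.
  by rewrite -[X in _ <= X](rmorph1 emb) -(nm_le HR) v1.
- by rewrite divr_gt0.
have h1 := le_trans (Tv i) (hK0 _ (leq_trans Ki (ltnW (st_gt i)))).
have h2 := le_trans (Tv j) (hK0 _ (leq_trans (leq_trans Ki (ltnW ij)) (ltnW (st_gt j)))).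
have h3 : nm lambda <= 2 * nm (lambda *: (v i - v j)).
  by rewrite (nmZ HR) mulrCA -[leLHS]mulr1 ler_wpM2l ?(nm_ge0 HR) ?sep.
have -> : T (v i) - lambda *: v i - (T (v j) - lambda *: v j) =
   (T (v i) - T (v j)) - lambda *: (v i - v j).
  by rewrite scalerBr !opprB addrACA [in RHS]addrACA [- _ + _ in RHS]addrC.
have := nmB HR (T (v i) - T (v j))
  ((T (v i) - T (v j)) - lambda *: (v i - v j)).
rewrite subKr; have := nmB HR (T (v i)) (T (v j)); lra.
Qed.

End BasisAndOperator.

(** * The operator attached to a system of levels *)

Section Assembly.
Context (R : realType) (K : numFieldType) (emb : {rmorphism R -> K})
  (re : K -> R) (HR : real_part emb re).
Context (X : completeNormedModType K) (U : set_system nat) (UU : UltraFilter U).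
Local Notation nm := (nm re).
Local Notation gen := (gen re U).

Context (y : nat -> nat -> X) (D : R) (yD : forall l i, nm (y l i) <= D).
Context (gamma : R) (gamma0 : 0 < gamma)
  (hgamma : forall b, gamma * nm b <= gen (y 0) [:: b] 0).
Context (rho : nat -> R) (m : nat -> nat) (x : nat -> X) (start : nat -> nat).
Context (rho0 : rho 0 = 2) (rho_gt0 : forall l, 0 < rho l)
  (rho_decr : forall l, rho l.+1 <= rho l)
  (rho_small : forall l, rho l.+1 <= 2^-1 ^+ l.+1).
Context (gen_large : rows_detect_large re U y rho m).
Context (gen_small : rows_control_small re U y rho m x start).
Context (Dx : R) (xD : forall i, nm (x i) <= Dx).
Context (gam : R) (gam0 : 0 < gam) (n0 : nat)
  (x_sep : forall p q p' q', (n0 <= p)%N -> (p < q)%N -> (q < p')%N ->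
     (p' < q')%N -> gam <= nm (x p - x q - (x p' - x q'))).

Proposition operator_of_levels : exists Y : set X,
  [/\ closed_subspace Y,
      exists e : nat -> X, schauder_basis e Y &
      exists T : X -> X, bounded_linear_on Y T /\
        ~ exists lambda : K, compact_operator_on Y (fun u => T u - lambda *: u)].
Proof.
(* Increasing indices such that d j lies beyond start l for all l <= j. *)
pose kap i := (i + \sum_(l < i.+1) start l)%N.
have kap_incr : {homo kap : i j / (i < j)%N}.
  apply: homo_ltn => [? ? ?|i]; first exact: ltn_trans.
  by rewrite /kap [X in (_ < _ + X)%N]big_ord_recr /= addSn ltnS leq_add2l leq_addr.
have kap_start l j : (l <= j)%N -> (start l <= kap j.*2)%N.
  move=> lj; have lj2 : (l < j.*2.+1)%N.
    by rewrite ltnS (leq_trans lj) // -addnn leq_addr.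
  rewrite /kap (bigD1 (Ordinal lj2)) //= addnCA leq_addr //.
have kap_ge i : (i <= kap i)%N by rewrite leq_addr.
pose d j := x (kap j.*2) - x (kap j.*2.+1).
(* The errors add up to at most mu, as required by [level_bound] and by
   [coef_bound]. *)
pose mu := Num.min 1 (gamma / 2).
have mu0 : 0 < mu by rewrite lt_min ltr01 divr_gt0.
pose delta j := mu * 2^-1 ^+ j.+1.
have delta0 j : 0 < delta j by rewrite mulr_gt0 // exprn_gt0 // invr_gt0.
have delta_sum n k : \sum_(i <- iota n k) delta i <= mu.
  apply: (@le_trans _ _ (\sum_(i < n + k) delta i)).
    by apply: sum_iota_le => // i; exact: ltW.
  rewrite -mulr_sumr -[leRHS]mulr1 ler_wpM2l ?(ltW mu0) //.
  suff -> N : \sum_(i < N) 2^-1 ^+ i.+1 = 1 - 2^-1 ^+ N :> R.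
    by rewrite gerBl exprn_ge0.
  elim: N => [|N IH]; first by rewrite big_ord0 expr0 subrr.
  by rewrite big_ord_recr /= IH exprS; lra.
have delta_gamma n k : \sum_(i <- iota n k) delta i <= gamma / 2.
  by rewrite (le_trans (delta_sum _ _)) // ge_min lexx orbT.
have delta_le1 n k : \sum_(i <- iota n k) delta i <= 1.
  by rewrite (le_trans (delta_sum _ _)) // ge_min lexx.
pose r j := (\sum_(l < j.+1) m l).+1.
have mr l j : (l <= j)%N -> (m l <= r j)%N.
  move=> lj; have lj1 : (l < j.+1)%N by [].
  by rewrite /r (bigD1 (Ordinal lj1)) //= -addnS leq_addr.
have [e [eD he]] := generic_sequence HR UU yD r delta0.
have coefB a N k : (k < N)%N -> nm (a k) <= 2 / gamma * nm (psum e a N).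
  exact: (coef_bound HR he gamma0 hgamma (fun=> isT) delta_gamma).
have prefix2 a n N : (n <= N)%N -> nm (psum e a n) <= 2 * nm (psum e a N).
  exact: (prefix_bound HR he gamma0 hgamma (fun=> isT) delta_gamma).
have few := few_large_coef HR UU yD he delta_le1 mr gen_large.
have small := level_small_coef HR UU yD he delta_le1 mr gen_large gen_small
  kap_incr kap_start.
have dD j : nm (d j) <= 2 * Dx.
  by apply: (le_trans (nmB HR _ _)); rewrite mulr2n mulrDl mul1r lerD.
have Dx0 : 0 <= Dx := le_trans (nm_ge0 HR _) (xD 0).
have dom := domination HR dD rho0 rho_gt0 rho_decr rho_small few small.
have tail := tail_bound HR dD rho_gt0 rho_decr rho_small small.
have e_neq0 i : e i != 0.
  apply/eqP => ei0; have := @coefB (fun j => (j == i)%:R) i.+1 i (ltnSn _).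
  rewrite eqxx (nm_nat HR 1) /psum big1 ?(nm0 HR) ?mulr0 ?ler10 // => j _.
  by have [->|_] := eqVneq (j : nat) i; rewrite ?ei0 ?scaler0 ?scale0r.
have B0 : 0 <= 2 / gamma by rewrite divr_ge0 // ltW.
set Cd := 4 + 2 * (2 * Dx) + (m 0)%:R * (2 * Dx) in dom.
have Cd0 : 0 <= Cd by rewrite !addr_ge0 // !mulr_ge0.
have domC a N : nm (psum d a N) <= Cd * (1 + 2 / gamma) * nm (psum e a N).
  have [S0|S0] := eqVneq (nm (psum e a N)) 0.
    rewrite S0 mulr0 /psum big1 ?(nm0 HR) // => i _.
    have := coefB a N i (ltn_ord i); rewrite S0 mulr0 => h.
    have /eqP : nm (a i) == 0 by rewrite eq_le h (nm_ge0 HR).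
    by move/eqP; rewrite (nm_eq0 HR) => /eqP->; rewrite scale0r.
  set c := (1 + 2 / gamma) * nm (psum e a N).
  have Sp : 0 < nm (psum e a N) by rewrite lt_def S0 (nm_ge0 HR).
  have c0 : 0 < c by rewrite mulr_gt0 // ltr_pwDl.
  have nc : nm (emb c^-1) = c^-1 by rewrite (nm_emb HR) gtr0_norm ?invr_gt0.
  pose a' i := if (i < N)%N then emb c^-1 * a i else 0.
  have a'1 i : nm (a' i) <= 1.
    rewrite /a'; case: ifP => [iN|_]; last by rewrite (nm0 HR).
    rewrite (nmM HR) nc mulrC ler_pdivrMr // mul1r (le_trans (coefB a N i iN)) //.
    by rewrite ler_wpM2r ?(nm_ge0 HR) // lerDr.
  have Sa' (f : nat -> X) : \sum_(i < N) a' i *: f i = emb c^-1 *: psum f a N.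
    rewrite scaler_sumr; apply: eq_bigr => i _.
    by rewrite /a' ltn_ord scalerA.
  have := dom a' N a'1; rewrite !Sa' !(nmZ HR) nc.
  rewrite ![c^-1 * _]mulrC !ler_pdivrMr // mul1r -mulrA -/c; apply.
  by rewrite -[leLHS]mul1r ler_wpM2r ?(nm_ge0 HR) // lerDl.
have flat n : (0 < n)%N -> exists (a : nat -> K) N,
  [/\ forall i, (i < n)%N -> a i = 0, nm (psum e a N) = 1,
      nm (psum d a N) <= (4 + 2 * Dx) * 2^-1 ^+ n &
      forall i, (N <= i)%N -> a i = 0].
  (* m n equal coefficients rho (n+1) already give a norm above 1; normalising
     makes them smaller still. *)
  move=> n_gt0; pose N := (n + m n)%N.
  pose a i : K := if (n <= i < N)%N then emb (rho n.+1) else 0.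
  have nmr : nm (emb (rho n.+1)) = rho n.+1.
    by rewrite (nm_emb HR) gtr0_norm.
  have r1 : rho n.+1 <= 1.
    apply: (le_trans (rho_small n)).
    by rewrite exprn_ile1 ?invr_ge0 // invf_le1 // ler1n.
  have a1 i : nm (a i) <= 1.
    by rewrite /a; case: ifP => _; rewrite ?nmr // (nm0 HR).
  have S1 : 1 < nm (psum e a N).
    rewrite ltNge; apply/negP => /(few a N n a1); rewrite ltnNge => /negP; apply.
    rewrite iotaD count_cat add0n.
    apply: leq_trans (leq_addl _ _); rewrite -[leqLHS](size_iota n) leq_eqVlt.
    apply/orP; left; rewrite eq_sym -all_count; apply/allP => i.
    by rewrite mem_iota /a => /andP[-> h]; rewrite h /= nmr lexx.
  have Sp : 0 < nm (psum e a N) := lt_trans ltr01 S1.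
  set s := nm (psum e a N) in S1 Sp.
  have ns : nm (emb s^-1) = s^-1 by rewrite (nm_emb HR) gtr0_norm ?invr_gt0.
  pose b i := emb s^-1 * a i.
  have bS (f : nat -> X) : psum f b N = emb s^-1 *: psum f a N.
    rewrite /psum scaler_sumr; apply: eq_bigr => i _; by rewrite scalerA.
  have sV : s^-1 < 1 by rewrite invf_lt1.
  have b_lt i : b i != 0 -> nm (b i) < rho n.
    rewrite /b /a; case: ifP => _; last by rewrite mulr0 eqxx.
    move=> _; rewrite (nmM HR) ns nmr; apply: lt_le_trans (rho_decr n).
    by rewrite -[ltRHS]mul1r ltr_pM2r.
  have b1 i : nm (b i) <= 1.
    by rewrite (nmM HR) ns -[leRHS]mul1r ler_pM ?(nm_ge0 HR) ?(ltW sV) ?invr_ge0 ?(ltW Sp).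
  have nb : nm (psum e b N) = 1 by rewrite bS (nmZ HR) ns mulVf // gt_eqF.
  exists b, N; split=> [i i_n||| i Ni] //.
  - by rewrite /b /a leqNgt i_n mulr0.
  - have := tail b N n b1; rewrite -/(psum e b N) nb lexx => /(_ isT n_gt0).
    rewrite [X in nm X <= _](_ : _ = psum d b N) // /psum [LHS]big_mkcond.
    apply: eq_bigr => i _; case: ifP => // /negbT h.
    have [->|bi0] := eqVneq (b i) 0; first by rewrite scale0r.
    move: h; rewrite b_lt // andbT -ltnNge => i_n.
    by rewrite /b /a leqNgt i_n mulr0 scale0r.
  - by rewrite /b /a ltnNge Ni andbF mulr0.
have d_sep i j : (n0 <= i)%N -> (i < j)%N -> gam <= nm (d i - d j).
  move=> ni ij; apply: x_sep.
  - by apply: leq_trans (kap_ge _); rewrite (leq_trans ni) // -addnn leq_addr.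
  - exact: kap_incr.
  - by apply: kap_incr; rewrite -doubleS leq_double in ij *; lia.
  - exact: kap_incr.
exists (expansions re e); split.
- split; first exact: (expansions_linear HR).
  exact: (expansions_closed HR coefB prefix2 e_neq0).
- by exists e; exact: (expansions_basis HR coefB e_neq0).
have [T [Tb Te]] := transfer_operator HR coefB prefix2 e_neq0 domC.
exists T; split => //.
exact: (transfer_noncompact HR prefix2 e_neq0 eD gam0 d_sep flat Tb Te).
Qed.

End Assembly.

(** * Spreading models, s.c. domination and Property P2 *)

Section SpreadingModels.
Context (R : realType) (K : numFieldType) (emb : {rmorphism R -> K})
  (re : K -> R) (HR : real_part emb re).
Local Notation nm := (nm re).

Lemma norm_emb (s : R) : `|emb s| = emb `|s|.
Proof. by rewrite -(emb_nm HR) (nm_emb HR). Qed.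

Definition place (p r : nat) (b : nat -> K) (i : nat) : K :=
  if (p <= i < p + r)%N then b (i - p)%N else 0.

Lemma sum_place (V : lmodType K) (p r N : nat) (b : nat -> K) (f : nat -> V) :
  (p + r <= N)%N ->
  \sum_(i < N) place p r b i *: f i = \sum_(i < r) b i *: f (p + i)%N.
Proof.
move=> prN; rewrite -(subnKC prN) big_split_ord /= big_split_ord /=.
rewrite big1 ?add0r => [|i _]; last by rewrite /place leqNgt ltn_ord scale0r.
rewrite [X in _ + X]big1 ?addr0 => [|i _]; last first.
  by rewrite /place [X in _ && X]ltnNge leq_addr andbF scale0r.
apply: eq_bigr => i _.
by rewrite /place leq_addr ltn_add2l ltn_ord addKn.
Qed.

(** Coefficients of a combination of consecutive differences, term by term. *)
Definition alternate (bs : seq K) (i : nat) : K :=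
  if odd i then - bs`_i./2 else bs`_i./2.

Lemma sum_alternate (V : lmodType K) (bs : seq K) r (f : nat -> V) :
  \sum_(i < r.*2) alternate bs i *: f i =
  \sum_(s < r) bs`_s *: (f s.*2 - f s.*2.+1).
Proof.
elim: r => [|r IH]; first by rewrite !big_ord0.
rewrite doubleS !big_ord_recr /= IH -addrA; congr (_ + _).
by rewrite /alternate /= odd_double uphalf_double doubleK scaleNr scalerBr.
Qed.

Lemma alternate_le bs c i : 0 <= c -> (forall b, b \in bs -> nm b <= c) ->
  nm (alternate bs i) <= c.
Proof.
move=> c0 bsc; have h j : nm (bs`_j) <= c.
  have [lt_j|ge_j] := ltnP j (size bs); first exact/bsc/mem_nth.
  by rewrite nth_default // (nm0 HR).
by rewrite /alternate; case: ifP => _; rewrite ?nmN.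
Qed.

Lemma alternate_ge bs c i : (i < (size bs).*2)%N ->
  (forall b, b \in bs -> c <= nm b) -> c <= nm (alternate bs i).
Proof.
move=> ibs bsc; have h : c <= nm (bs`_i./2).
  by apply/bsc/mem_nth; rewrite ltn_half_double.
by rewrite /alternate; case: ifP => _; rewrite ?nmN.
Qed.

Lemma basic_free (V : completeNormedModType K) (e : nat -> V) r (b : nat -> K) :
  basic_sequence e -> \sum_(i < r) b i *: e i = 0 -> forall i, (i < r)%N -> b i = 0.
Proof.
move=> [_ /(_ 0)[]] => [|a [_ ua] Sb i ir].
  by apply: subset_closure => /=; exists 0%N, (fun=> 0); rewrite big_ord0.
have stat (c : nat -> K) N : (forall n, (N <= n)%N -> \sum_(i < n) c i *: e i = 0) ->
    series (fun i => c i *: e i) @ \oo --> (0 : V).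
  move=> h; apply/(tendsP HR); rewrite seriesEord; exact: (tends_stationary HR h).
have a0 : a = (fun=> 0).
  apply: ua; apply: (stat _ 0%N) => n _.
  by rewrite big1 // => j _; rewrite scale0r.
have ab : a = fun j => if (j < r)%N then b j else 0.
  apply: ua; apply: (stat _ r) => n rn.
  rewrite -(subnKC rn) big_split_ord /= [X in _ + X]big1 ?addr0.
    by rewrite -[RHS]Sb; apply: eq_bigr => j _; rewrite ltn_ord.
  by move=> j _; rewrite ltnNge leq_addr scale0r.
by have := congr1 (fun c => c i) (esym ab); rewrite a0 ir.
Qed.

(** The offset p is free because spreading models are invariant under spreading;
    the combination is padded with zeros to the length that makes the error
    small. *)
Lemma spreading_estimate (V W : completeNormedModType K) (x : nat -> V)
    (xt : nat -> W) (m p : nat) (eta : R) : spreading_model x xt -> 0 < eta ->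
  exists P, forall r (b : nat -> K) (k : nat -> nat), (r <= m)%N ->
    (forall i, nm (b i) <= 1) -> (P <= k 0)%N ->
    (forall i, (i.+1 < r)%N -> (k i < k i.+1)%N) ->
    `|nm (\sum_(i < r) b i *: x (k i)) - nm (\sum_(i < r) b i *: xt (p + i)%N)|
      <= eta.
Proof.
move=> [_ [eps [_ eps0 heps]]] eta0.
have e0 : 0 < emb eta by rewrite (emb_gt0 HR).
have /cvgrPdist_lt/(_ _ e0)[n0 _ hn0] := eps0.
pose n := (n0 + (p + m))%N; exists (n + p)%N => r b k rm b1 Pk kinc.
(* Extend k to increasing indices that leave room for the p leading zeros. *)
pose kk i := if (i < p)%N then (n + i)%N else if (i < p + r)%N then k (i - p)%N
  else (i + n + \sum_(s < r) k s)%N.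
have kk_incr : {homo kk : i j / (i < j)%N}.
  apply: homo_ltn => [? ? ?|i]; first exact: ltn_trans.
  rewrite /kk; have [ip|pi] := ltnP i.+1 p.
    by rewrite (ltnW ip) addnS.
  have [ip|pi'] := ltnP i p.
    have Ei : i.+1 = p by apply/eqP; rewrite eqn_leq ip pi.
    rewrite Ei subnn; case: ifP => _; last by lia.
    by apply: leq_trans Pk; rewrite -Ei addnS.
  have [ir|ri] := ltnP i.+1 (p + r).
    rewrite (ltn_trans (ltnSn _) ir) subSn //; apply: kinc.
    by rewrite -subSn // ltn_subLR // (leq_trans pi').
  have [ir|ri'] := ltnP i (p + r); last by rewrite !addSn.
  have lt_r : (i - p < r)%N by rewrite ltn_subLR.
  by rewrite (bigD1 (Ordinal lt_r)) //=; lia.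
have kk_ge i : (n <= kk i)%N.
  have h0 : (n <= kk 0)%N.
    rewrite /kk; case: ifP => _; first by rewrite addn0.
    case: ifP => // h; last by lia.
    by rewrite sub0n; apply: leq_trans Pk; rewrite leq_addr.
  by case: i => // i; apply: (leq_trans h0); apply: ltnW; apply: kk_incr.
have := heps n (fun i => place p r b i) (fun i => kk i).
have prn : (p + r <= n.+1)%N by rewrite /n; lia.
rewrite (sum_place b (x \o kk) prn) (sum_place b xt prn).
have -> : \sum_(i < r) b i *: (x \o kk) (p + i)%N = \sum_(i < r) b i *: x (k i).
  apply: eq_bigr => i _; rewrite /kk /= ltnNge leq_addr /= ltn_add2l ltn_ord.
  by rewrite addKn.
have place1 i : `|place p r b i| <= 1.
  rewrite -[leRHS](rmorph1 emb) -(nm_le HR) /place.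
  by case: ifP => _; rewrite ?b1 // (nm0 HR).
move=> /(_ (fun i => place1 i) (fun i j => kk_incr i j) (fun i => kk_ge i)) h.
set u := \sum_(_ < _) _ *: x _ in h *; set w := \sum_(_ < _) _ *: xt _ in h *.
rewrite -(emb_nm HR u) -(emb_nm HR w) -rmorphB norm_emb in h.
have := hn0 n (leq_addr _ _); rewrite /= sub0r normrN => h2.
rewrite -(real_part_mono HR); apply: ltW; apply: (lt_trans h).
have epsn : 0 <= eps n by apply: le_trans (ltW h); rewrite (emb_ge0 HR).
by rewrite ger0_norm in h2.
Qed.

(** Suprema in the extended scalars are chosen among the least upper bounds, if
    there are any. They exist for sets of nonnegative reals, where a real upper
    bound in K is itself a nonnegative real. *)
Lemma supremum_ub_nonneg (A : set R) (S : set (\bar K)) : A !=set0 ->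
  (forall s, A s -> 0 <= s) -> S = [set (emb s)%:E | s in A] ->
  ubound S (supremum -oo%E S).
Proof.
move=> [a Aa] A0 SA; rewrite /supremum.
have S0 : S != set0.
  by apply/set0P; exists (emb a)%:E; rewrite SA; exists a.
rewrite (negbTE S0).
suff [s hs] : exists s, supremums S s by have [] := xgetPex -oo%E (ex_intro _ s hs).
have ub_fin c : ubound S c%:E -> 0 <= c /\ forall s, A s -> s <= re c.
  move=> uc; have h s : A s -> emb s <= c.
    by move=> As; rewrite -lee_fin; apply: uc; rewrite SA; exists s.
  have c0 : 0 <= c by apply: le_trans (h _ Aa); rewrite (emb_ge0 HR) A0.
  by split => // s /h; rewrite -{1}(real_partK HR c0) (real_part_mono HR).
have not_noo : ~ ubound S -oo%E.
  move=> u; have := u (emb a)%:E; rewrite SA => /(_ (ex_intro2 _ _ a Aa erefl)).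
  by rewrite leeNy_eq.
have [[M AM]|unb] := pselect (exists M, ubound A M); last first.
  exists +oo%E; split.
    rewrite SA => _ [s As <-]; rewrite real_leey /=.
    by apply/ger0_real; rewrite (emb_ge0 HR) A0.
  move=> [c| |] uc //.
  by case: unb; exists (re c) => s; have [_] := ub_fin c uc; apply.
have hA : has_sup A by split; [exists a|exists M].
exists (emb (sup A))%:E; split=> [|u].
  rewrite SA => _ [s As <-]; rewrite lee_fin (real_part_mono HR).
  exact: sup_upper_bound.
case: u => [c| |] uc //.
  have [c0 cA] := ub_fin c uc; rewrite lee_fin -(real_partK HR c0).
  by rewrite (real_part_mono HR); apply: ge_sup => //; exists a.
rewrite real_leey /=; apply/ger0_real; rewrite (emb_ge0 HR).
exact: le_trans (A0 _ Aa) (sup_upper_bound hA Aa).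
Qed.

(** By homogeneity, the bound 1 on the combination of z can be replaced by A. *)
Lemma sc_dominates_small (V W : completeNormedModType K) (z : nat -> W)
    (xt : nat -> V) (A eta : R) : sc_dominates z xt -> 0 < A -> 0 < eta ->
  exists rho, 0 < rho /\ forall r (b : nat -> K), (forall i, nm (b i) <= rho) ->
    nm (\sum_(i < r) b i *: z i) <= A -> nm (\sum_(i < r) b i *: xt i) <= eta.
Proof.
move=> sc A0 eta0.
have e0 : 0 < emb (eta / A) by rewrite (emb_gt0 HR) divr_gt0.
have nb : nbhs (0%:E : \bar K)
    [set y | exists2 c, y = c%:E & `|c| < emb (eta / A)].
  have := nbhsx_ballx (0 : K) _ e0; apply: filterS => c /=.
  by rewrite -ball_normE /= sub0r normrN => h; exists c.
have [d /= d0 hd] := sc _ nb.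
have d20 : 0 < d / 2 by rewrite divr_gt0.
have [|c Dc cA] := hd (d / 2) _ d20.
  by rewrite /= sub0r normrN gtr0_norm // ltr_pdivrMr // ltr_pMr // ltr1n.
have dE : emb (re (d / 2)) = d / 2 by rewrite (real_partK HR) // ltW.
exists (A * re (d / 2)); split.
  by rewrite mulr_gt0 // -(emb_gt0 HR) dE.
move=> r b bA SA.
have nA : nm (emb A^-1) = A^-1 by rewrite (nm_emb HR) gtr0_norm ?invr_gt0.
have scal (Q : completeNormedModType K) (f : nat -> Q) :
    \sum_(i < r) (emb A^-1 * b i) *: f i = emb A^-1 *: \sum_(i < r) b i *: f i.
  by rewrite scaler_sumr; apply: eq_bigr => i _; rewrite scalerA.
have := @supremum_ub_nonneg [set s | exists (N : nat) (a : 'I_N -> K),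
    [/\ forall i, `|a i| <= d / 2, `|\sum_(i < N) a i *: z i| <= 1 &
        s = nm (\sum_(i < N) a i *: xt i)]]
  [set r | exists (N : nat) (a : 'I_N -> K),
    [/\ forall i, `|a i| <= d / 2, `|\sum_(i < N) a i *: z i| <= 1 &
        r = (`|\sum_(i < N) a i *: xt i|)%:E]] _ _ _.
rewrite -/(sc_Delta z xt (d / 2)) Dc => h.
have : (`|\sum_(i < r) (emb A^-1 * b i) *: xt i|%:E <= c%:E)%E.
  apply: h.
  - exists (nm (0 : V)), 0%N, (fun=> 0); split => [[]//||].
      by rewrite big_ord0 normr0.
    by rewrite big_ord0.
  - by move=> s [N [a [_ _ ->]]]; exact: (nm_ge0 HR).
  - apply/seteqP; split => [_ [N [a [h1 h2 ->]]]|_ [s [N [a [h1 h2 ->]]] <-]].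
      exists (nm (\sum_(i < N) a i *: xt i)); last by rewrite (emb_nm HR).
      by exists N, a.
    by exists N, a; rewrite (emb_nm HR).
  - exists r, (fun i : 'I_r => emb A^-1 * b i); split => // [i|].
      rewrite -dE -(nm_le HR) (nmM HR) nA mulrC ler_pdivrMr // mulrC.
      exact: bA.
    rewrite scal -[leRHS](rmorph1 emb) -(nm_le HR) (nmZ HR) nA mulrC.
    by rewrite ler_pdivrMr // mul1r.
rewrite lee_fin scal => h1.
have c0 : 0 <= c by apply: le_trans h1.
rewrite ger0_norm // in cA; have := le_lt_trans h1 cA.
rewrite -(nm_lt HR) (nmZ HR) nA mulrC ltr_pM2r ?invr_gt0 //; exact: ltW.
Qed.

(** Property P2 for vectors of norm at most A: normalising multiplies the
    coefficients by at least 1 / A. *)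
Lemma property_P2_count (V : completeNormedModType K) (zt : nat -> V) (A rho : R) :
  basic_sequence zt -> property_P2 zt -> 0 < A -> 0 < rho ->
  exists M, forall r (b : nat -> K), (forall i, (i < r)%N -> rho <= nm (b i)) ->
    nm (\sum_(i < r) b i *: zt i) <= A -> (r <= M)%N.
Proof.
move=> bz P2 A0 rho0.
have e0 : 0 < emb (rho / A) by rewrite (emb_gt0 HR) divr_gt0.
have [M hM] := P2 _ e0; exists M => r b rb SA.
case: r rb SA => // r rb SA; set v := \sum_(i < r.+1) _ in SA.
have v0 : v != 0.
  apply/eqP => /(basic_free bz)/(_ 0%N isT) b0; have := rb 0%N isT.
  by rewrite b0 (nm0 HR) leNgt rho0.
have nv0 : 0 < nm v by rewrite (nm_gt0 HR).
have nV : nm (emb (nm v)^-1) = (nm v)^-1.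
  by rewrite (nm_emb HR) gtr0_norm ?invr_gt0.
pose a i := if (i < r.+1)%N then emb (nm v)^-1 * b i else 0.
have := hM a (emb (nm v)^-1 *: v).
have ta : series (fun i => a i *: zt i) @ \oo --> emb (nm v)^-1 *: v.
  apply/(tendsP HR); rewrite seriesEord; apply: (tends_stationary HR (N := r.+1)).
  move=> n rn /=; rewrite -(subnKC rn) big_split_ord /= [X in _ + X]big1 ?addr0.
    rewrite scaler_sumr; apply: eq_bigr => i _.
    by rewrite /a ltn_ord scalerA.
  by move=> i _; rewrite /a ltnNge leq_addr scale0r.
move=> /(_ ta); rewrite -(emb_nm HR) (nmZ HR) nV mulVf ?gt_eqF // rmorph1.
move=> /(_ erefl) cM; rewrite -card_le_II; apply: card_le_trans cM.
apply: subset_card_le => i /= ir.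
rewrite -(nm_ge HR) /a ir (nmM HR) nV [leRHS]mulrC ler_pdivlMr //.
by apply: (le_trans _ (rb i ir)); rewrite mulrAC ler_pdivrMr // ler_wpM2l // ltW.
Qed.

Context (X Z : completeNormedModType K) (U : set_system nat)
  (UU : UltraFilter U) (Ufree : forall k, U [set n | (k <= n)%N]).
Local Notation gen := (gen re U).
Context (xn : nat -> nat -> X) (z : nat -> Z) (D : R)
  (xnD : forall n i, nm (xn n i) <= D).
Context (C : R) (C0 : 0 < C).
Context (hdom : forall n, exists (V : completeNormedModType K) (yt : nat -> V),
  spreading_model (xn n) yt /\
  forall a : 'I_n.+1 -> K,
    nm (\sum_(i < n.+1) a i *: z i) <= C * nm (\sum_(i < n.+1) a i *: yt i)).

(** Row n dominates blocks of z that end before n, at any offset p, since its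
    spreading model can be spread to the same offset. *)
Lemma gen_dominates n p bs : (p + (size bs).*2 <= n.+1)%N ->
  (forall b, b \in bs -> nm b <= 1) ->
  nm (\sum_(i < (size bs).*2) alternate bs i *: z (p + i)%N) <=
  C * gen (xn n) bs 0.
Proof.
move=> pn bs1; have [V [yt [sm dom]]] := hdom n.
have alt1 i : nm (alternate bs i) <= 1 by apply: alternate_le.
set S := nm _; rewrite mulrC -ler_pdivrMr //.
apply/ler_addgt0Pr => eta eta0; rewrite -lerBlDr.
have [P hP] := spreading_estimate (size bs).*2 p sm eta0.
apply: (gen_ge HR UU (xnD n) Ufree (N := P)) => k Pk kinc.
rewrite add0r -(sum_alternate bs (size bs) (fun i => xn n (k i))).
have := hP (size bs).*2 (alternate bs) k (leqnn _) alt1 Pk kinc.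
rewrite ler_norml => /andP[h _].
have := dom (fun i => place p (size bs).*2 (alternate bs) i).
rewrite !sum_place // -/S mulrC -ler_pdivrMr // => h2.
by rewrite lerBlDr (le_trans h2) //; lra.
Qed.

(** Property P2 for the spreading model of z bounds the number of large
    coefficients of a vector of norm at most A; this bound is known before the
    row is chosen, so the row can be taken far enough to dominate z on the
    blocks needed. *)
Lemma level_row (V : completeNormedModType K) (zt : nat -> V) (A rho : R) :
  spreading_model z zt -> property_P2 zt -> 0 < A -> 0 < rho ->
  exists m n,
    (forall bs, size bs = m -> (forall b, b \in bs -> rho <= nm b <= 1) ->
      A < gen (xn n) bs 0) /\
    (forall bs, (size bs <= m)%N -> (forall b, b \in bs -> nm b <= 1) ->
      nm (\sum_(i < (size bs).*2) alternate bs i *: z i) <= C * gen (xn n) bs 0).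
Proof.
move=> sm P2 A0 rho0.
have bz : basic_sequence zt by case: sm => -[].
have CA1 : 0 < C * A + 1 by rewrite ltr_wpDl // mulr_ge0 // ltW.
have [M hM] := property_P2_count bz P2 CA1 rho0.
pose m := M.+1; have [P hP] := spreading_estimate m.*2 0 sm ltr01.
exists m, (P + m.*2)%N; split=> bs sbs bs1; last first.
  apply: (@gen_dominates _ 0) => //.
  by rewrite add0n ltnW // ltnS (leq_trans _ (leq_addl _ _)) // leq_double.
have bs1' b : b \in bs -> nm b <= 1 by move=> /bs1/andP[].
rewrite ltNge; apply/negP => gA.
have alt1 i : nm (alternate bs i) <= 1 by apply: alternate_le.
have h1 := @gen_dominates (P + m.*2)%N P bs _ bs1'.
have {}h1 := fun pn => le_trans (h1 pn) (ler_wpM2l (ltW C0) gA).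
rewrite sbs in h1.
have incr i : (i.+1 < m.*2)%N -> (P + i < P + i.+1)%N by rewrite ltn_add2l.
have P0 : (P <= P + 0)%N by rewrite addn0.
have := hP m.*2 (alternate bs) (fun i => (P + i)%N) (leqnn _) alt1 P0 incr.
rewrite ler_norml => /andP[h2 _].
have m_le : (m.*2 <= M)%N.
  apply: (hM _ (alternate bs)) => [i im|]; last first.
    have := h1 (leqnSn _); move: h2.
    have -> : \sum_(i < m.*2) alternate bs i *: zt (0 + i)%N =
      \sum_(i < m.*2) alternate bs i *: zt i by apply: eq_bigr => i _; rewrite add0n.
    lra.
  by apply: alternate_ge => [|b /bs1/andP[]//]; rewrite sbs.
by move: m_le; rewrite /m -addnn; lia.
Qed.

Lemma sum_alternate_neq0 (V : completeNormedModType K) (e : nat -> V) bs :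
  basic_sequence e -> bs`_0 != 0 ->
  0 < nm (\sum_(i < (size bs).*2) alternate bs i *: e i).
Proof.
move=> be b0; rewrite (nm_gt0 HR); apply: contraNneq b0 => /(basic_free be) h.
have [s0|s0] := posnP (size bs); first by rewrite nth_default // s0.
by have := h 0%N; rewrite double_gt0 => /(_ s0) /eqP.
Qed.

(** The thresholds depend only on s.c. domination; each one fixes, through
    [level_row], the row used at the preceding level. *)
Proposition operator_of_spreading_models (V W : completeNormedModType K)
    (x : nat -> X) (xt : nat -> V) (zt : nat -> W) (Dx : R) :
  basic_sequence z -> (forall i, nm (x i) <= Dx) ->
  spreading_model x xt -> sc_dominates z xt ->
  spreading_model z zt -> property_P2 zt ->
  exists Y : set X,
  [/\ closed_subspace Y,
      exists e : nat -> X, schauder_basis e Y &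
      exists T : X -> X, bounded_linear_on Y T /\
        ~ exists lambda : K, compact_operator_on Y (fun u => T u - lambda *: u)].
Proof.
move=> bz xD smx scx smz P2.
have half_gt0 l : 0 < 2^-1 ^+ l :> R by rewrite exprn_gt0 // invr_gt0.
have two_gt0 l : 0 < 2 ^+ l :> R by rewrite exprn_gt0.
have A0 l : 0 < 4 * 2 ^+ l :> R by rewrite mulr_gt0.
have /choice[rs hrs] : forall l, exists rs, 0 < rs /\
    forall r (b : nat -> K), (forall i, nm (b i) <= rs) ->
    nm (\sum_(i < r) b i *: z i) <= C * (4 * 2 ^+ l) ->
    nm (\sum_(i < r) b i *: xt i) <= 2^-1 ^+ l.
  by move=> l; apply: sc_dominates_small => //; rewrite mulr_gt0.
pose fix rho l : R := if l is l'.+1 then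
  Num.min (rho l') (Num.min (rs l) (2^-1 ^+ l)) else 2.
have rho_gt0 l : 0 < rho l.
  by elim: l => //= l IH; rewrite !lt_min IH half_gt0 (hrs l.+1).1.
have rho_decr l : rho l.+1 <= rho l by rewrite /= ge_min lexx.
have rho_small l : rho l.+1 <= 2^-1 ^+ l.+1 by rewrite /= !ge_min lexx !orbT.
have rho_rs l : rho l.+1 <= rs l.+1 by rewrite /= !ge_min lexx !orbT.
have /choice[mn hmn] : forall l, exists mn : nat * nat,
    (forall bs, size bs = mn.1 -> (forall b, b \in bs -> rho l.+1 <= nm b <= 1) ->
      4 * 2 ^+ l < gen (xn mn.2) bs 0) /\
    (forall bs, (size bs <= mn.1)%N -> (forall b, b \in bs -> nm b <= 1) ->
      nm (\sum_(i < (size bs).*2) alternate bs i *: z i)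
        <= C * gen (xn mn.2) bs 0).
  move=> l; have [m [n h]] := level_row smz P2 (A0 l) (rho_gt0 l.+1).
  by exists (m, n).
have /choice[start hstart] := fun l =>
  spreading_estimate ((mn l).1.*2) 0 smx (half_gt0 l).
have bxt : basic_sequence xt by case: smx => -[].
have gamma0 : 0 < nm (\sum_(i < 2) alternate [:: 1] i *: z i) / C.
  by rewrite divr_gt0 // (@sum_alternate_neq0 _ z [:: 1]) ?oner_eq0.
have xt4 : 0 < nm (\sum_(i < 4) alternate [:: 1; -1] i *: xt i) / 2.
  by rewrite divr_gt0 // (@sum_alternate_neq0 _ xt [:: 1; -1]) ?oner_eq0.
have [P4 hP4] := spreading_estimate 4 0 smx xt4.
(* Otherwise the empty combination would have a large norm. *)
have m0 : (0 < (mn 0).1)%N.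
  rewrite lt0n; apply/eqP => m0; have [/(_ [::] (esym m0)) h _] := hmn 0%N.
  have {}h : 4 * 2 ^+ 0 < nm (0 : X) by apply: h.
  by move: h; rewrite (nm0 HR) ltNge ltW.
pose y l := xn (mn l).2.
have yD l i : nm (y l i) <= D by exact: xnD.
apply: (operator_of_levels HR UU yD gamma0 _ (erefl (rho 0)) rho_gt0 rho_decr
  rho_small (m := fun l => (mn l).1) (x := x) (start := start) _ _ xD xt4
  (n0 := P4)).
- move=> b; have := genZ HR UU (yD 0%N) b [:: 1] 0.
  rewrite /= mulr1 scaler0 => ->; rewrite mulrC ler_wpM2l ?(nm_ge0 HR) //.
  rewrite ler_pdivrMr // mulrC; have [_ /(_ [:: 1] m0)] := hmn 0%N; apply => b'.
  by rewrite inE => /eqP->; rewrite (nm_nat HR 1).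
- by move=> l bs; have [h _] := hmn l; exact: h.
- move=> [//|l] bs k _ sbs bsr bs1 gbs Pk kinc.
  have alt1 i : nm (alternate bs i) <= 1 by apply: alternate_le.
  have altr i : nm (alternate bs i) <= rs l.+1.
    apply: alternate_le; first exact: ltW (hrs _).1.
    by move=> b /bsr h; exact: le_trans h (rho_rs l).
  have [_ /(_ bs sbs bs1) h1] := hmn l.+1.
  have h2 := (hrs l.+1).2 _ _ altr (le_trans h1 (ler_wpM2l (ltW C0) gbs)).
  rewrite -(sum_alternate bs (size bs) (fun i => x (k i))).
  have sbs2 : ((size bs).*2 <= (mn l.+1).1.*2)%N by rewrite leq_double.
  have := hstart l.+1 _ _ _ sbs2 alt1 Pk kinc.
  rewrite ler_norml => /andP[_ h3].
  have h4 : \sum_(i < (size bs).*2) alternate bs i *: xt (0 + i)%N =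
    \sum_(i < (size bs).*2) alternate bs i *: xt i.
    by apply: eq_bigr => i _; rewrite add0n.
  by rewrite h4 in h3; lra.
move=> p q p' q' Pp pq qp' p'q'.
pose k i := nth q' [:: p; q; p'] i.
have alt1 i : nm (alternate [:: 1; -1] i) <= 1.
  apply: alternate_le => // b; rewrite !inE => /orP[]/eqP->; rewrite ?nmN (nm_nat HR 1) //.
have kinc i : (i.+1 < 4)%N -> (k i < k i.+1)%N by case: i => [|[|[|]]].
have := hP4 4%N _ k (leqnn _) alt1 Pp kinc.
have -> : \sum_(i < 4) alternate [:: 1; -1] i *: x (k i) =
    x p - x q - (x p' - x q').
  rewrite (sum_alternate [:: 1; -1] 2 (fun i => x (k i))).
  by rewrite !big_ord_recl big_ord0 /k /= addr0 scale1r scaleN1r.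
have -> : \sum_(i < 4) alternate [:: 1; -1] i *: xt (0 + i)%N =
    \sum_(i < 4) alternate [:: 1; -1] i *: xt i.
  by apply: eq_bigr => i _; rewrite add0n.
by rewrite ler_norml => /andP[h _]; lra.
Qed.

End SpreadingModels.

(** * The two scalar fields *)

Lemma real_part_id (R : realType) :
  @real_part R R [the {rmorphism R -> R} of idfun] idfun.
Proof.
split=> // T V f UV f1; exists (ulim V f) => eta eta0.
by apply: ulimP => //; exists 1.
Qed.

Lemma sqrt_sumsq_le (R : rcfType) (a b : R) :
  Num.sqrt (a ^+ 2 + b ^+ 2) <= `|a| + `|b|.
Proof.
rewrite -[leRHS]ger0_norm ?addr_ge0 // -[leRHS]sqrtr_sqr ler_wsqrtr //.
rewrite sqrrD !real_normK ?num_real // lerD2r lerDl.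
by rewrite mulrn_wge0 // mulr_ge0.
Qed.

Lemma real_part_Re (R : realType) :
  @real_part R R[i] [the {rmorphism R -> R[i]} of real_complex R] (@complex.Re R).
Proof.
split=> [r s|k k0|T V f UV f1]; first exact: lecR.
  by rewrite /= RRe_real // ger0_real.
have sqrt_le t : Num.sqrt (complex.Re (f t) ^+ 2 + complex.Im (f t) ^+ 2) <= 1.
  by have := f1 t; rewrite normc_def -[leRHS](rmorph1 (real_complex R)) lecR.
have bRe : bounded_real (fun t => complex.Re (f t)).
  exists 1 => t; apply: le_trans (sqrt_le t).
  by rewrite -sqrtr_sqr ler_wsqrtr // lerDl sqr_ge0.
have bIm : bounded_real (fun t => complex.Im (f t)).
  exists 1 => t; apply: le_trans (sqrt_le t).
  by rewrite -sqrtr_sqr ler_wsqrtr // lerDr sqr_ge0.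
exists (Complex (ulim V (fun t => complex.Re (f t)))
  (ulim V (fun t => complex.Im (f t)))) => eta eta0.
have e0 : 0 < eta / 2 by rewrite divr_gt0.
apply: filterS2 (ulimP UV bRe e0) (ulimP UV bIm e0) => t /= h1 h2.
case: (f t) h1 h2 => u w /= h1 h2.
by apply: (le_lt_trans (sqrt_sumsq_le _ _)); lra.
Qed.

Proposition operator_of_real_part (R : realType) (K : numFieldType)
  (emb : {rmorphism R -> K}) (re : K -> R) (HR : real_part emb re)
  (X Z : completeNormedModType K)
  (x : nat -> X) (xn : nat -> nat -> X) (z : nat -> Z) :
  seminormalized x ->
  (exists c d : K, 0 < c /\ forall n i, c <= `|xn n i| <= d) ->
  basic_sequence z ->
  (exists (V : completeNormedModType K) (xt : nat -> V),
      spreading_model x xt /\ sc_dominates z xt) ->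
  (exists C : K, forall n : nat,
      exists (V : completeNormedModType K) (xnt : nat -> V),
        spreading_model (xn n) xnt /\ dominated C n.+1 z xnt) ->
  (exists (V : completeNormedModType K) (zt : nat -> V),
      spreading_model z zt /\ property_P2 zt) ->
  exists Y : set X,
    [/\ closed_subspace Y,
        exists e : nat -> X, schauder_basis e Y &
        exists T : X -> X,
          bounded_linear_on Y T /\
          ~ exists lambda : K,
              compact_operator_on Y (fun u => T u - lambda *: u)].
Proof.
move=> [cx [dx [_ hx]]] [c [d [_ hxn]]] bz [V [xt [smx sc]]] [C hC].
move=> [W [zt [smz P2]]].
have le_re (Q : completeNormedModType K) (v : Q) k : `|v| <= k -> nm re v <= re k.
  by move=> vk; rewrite (nm_le HR) (real_partK HR) // (le_trans _ vk).
have [U [UU Ufree]] := free_ultrafilter.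
have C0 : 0 <= C.
  have [Q [yt [[[[c' [d' [c'0 hyt]]] _] _] dom]]] := hC 0%N.
  have y0 : 0 < `|yt 0%N| by apply: lt_le_trans c'0 _; case/andP: (hyt 0%N).
  have := dom (fun=> 1); rewrite !big_ord1 !scale1r => h.
  by rewrite -(pmulr_lge0 _ y0); apply: le_trans h.
have reC0 : 0 <= re C by rewrite -(emb_ge0 HR) (real_partK HR).
apply: (operator_of_spreading_models HR UU Ufree (xn := xn) (D := re d)
  (C := re C + 1) _ _ _ bz _ smx sc smz P2 (Dx := re dx)).
- by move=> n i; apply: le_re; case/andP: (hxn n i).
- by rewrite ltr_wpDl.
- move=> n; have [Q [yt [sm dom]]] := hC n; exists Q, yt; split => // a.
  have h : nm re (\sum_(i < n.+1) a i *: z i) <=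
      re C * nm re (\sum_(i < n.+1) a i *: yt i).
    by rewrite (nm_le HR) rmorphM (real_partK HR) // (emb_nm HR); exact: dom.
  by apply: (le_trans h); rewrite ler_wpM2r ?(nm_ge0 HR) // lerDl.
- by move=> i; apply: le_re; case/andP: (hx i).
Qed.

Theorem theorem0p7 (R : realType) (K : numFieldType)
  (hK : K = (R : numFieldType) \/ K = (R[i] : numFieldType))
  (X Z : completeNormedModType K)
  (x : nat -> X) (xn : nat -> nat -> X) (z : nat -> Z)
  (hx : seminormalized_basic x)
  (hxn : forall n, seminormalized_basic (xn n))
  (hxn_unif : exists c d : K, 0 < c /\ forall n i, c <= `|xn n i| <= d)
  (hz : seminormalized_basic z)
  (h1 : exists (V : completeNormedModType K) (xt : nat -> V),
      spreading_model x xt /\ sc_dominates z xt)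
  (h2 : exists C : K, forall n : nat,
      exists (V : completeNormedModType K) (xnt : nat -> V),
        spreading_model (xn n) xnt /\ dominated C n.+1 z xnt)
  (h3 : exists (V : completeNormedModType K) (zt : nat -> V),
      spreading_model z zt /\ property_P2 zt) :
  exists Y : set X,
    [/\ closed_subspace Y,
        exists e : nat -> X, schauder_basis e Y &
        exists T : X -> X,
          bounded_linear_on Y T /\
          ~ exists lambda : K,
              compact_operator_on Y (fun u => T u - lambda *: u)].
Proof.
case: hK X Z x xn z hx hxn hxn_unif hz h1 h2 h3 => ->.
  move=> X Z x xn z [hx _] _ hxn [_ hz].
  exact: (operator_of_real_part (real_part_id R) hx hxn hz).
move=> X Z x xn z [hx _] _ hxn [_ hz].
exact: (operator_of_real_part (real_part_Re R) hx hxn hz).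
Qed.
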